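(* Let $G$ be a unimodular totally disconnected locally compact group, and let $P$ be a finitely generated projective discrete left $\mathbb{Q}[G]$-module with Hattori--Stallings rank $\tilde\rho(P)\in\mathbf{h}_G$. Then $\tilde\rho(P)\geq 0$. Moreover, $\tilde\rho(P)=0$ if, and only if, $P=0$.
   Context: Let $G$ be a unimodular totally disconnected locally compact (t.d.l.c.) group and let $\mathcal{CO}(G)$ be the set of its compact open subgroups. For $U,V\in\mathcal{CO}(G)$ put $|U:V|=|U:U\cap V|/|V:U\cap V|\in\mathbb{Q}^+$. For $U\in\mathcal{CO}(G)$ let $\mu_U$ be the Haar measure of $G$ with $\mu_U(U)=1$; thus $\mu_V=|U:V|\cdot\mu_U$. Put $\mathbf{h}_G=\mathbb{Q}\cdot\mu_{U}$, a one-dimensional $\mathbb{Q}$-vector space independent of $U$. For $\lambda\in\mathbf{h}_G$ write $\lambda>0$ if $\lambda\in\mathbb{Q}^+\cdot\mu_U$ with $\mathbb{Q}^+$ the positive rationals, and $\lambda\ge 0$ if $\lambda>0$ or $\lambda=0$. A left $\mathbb{Q}[G]$-module $M$ is discrete if the stabilizer $G_m$ of every $m\in M$ is open in $G$. Discrete left $\mathbb{Q}[G]$-modules form a full abelian subcategory ${}_{\mathbb{Q}[G]}\mathbf{dis}$ of all left $\mathbb{Q}[G]$-modules; ''projective'' means projective in this category. A discrete module is finitely generated if it is a quotient of $\bigoplus_{i=1}^n\mathbb{Q}[G/U_i]$ for some $U_1,\dots,U_n\in\mathcal{CO}(G)$. Standard bimodule: $\mathrm{Bi}(G)=\varinjlim_{U\in\mathcal{CO}(G)}\mathbb{Q}[G/U]$,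 where for $V\subseteq U$ the transition map is $gU\mapsto |U:V|^{-1}\sum_{r}grV$ ($r$ over representatives of the cosets $rV$ in $U$). It is a discrete left $\mathbb{Q}[G]$-module and a right $\mathbb{Q}[G]$-module via $(xU)\cdot g=xgU^g$, $U^g=g^{-1}Ug$. For every discrete left module $M$ there is an isomorphism $\theta_M\colon\mathrm{Bi}(G)\otimes_{\mathbb{Q}[G]}M\to M$, $\theta_M(gU\otimes m)=|U:U\cap G_m|^{-1}\sum_{r}gr\cdot m$ ($r$ over representatives of left cosets of $U\cap G_m$ in $U$). Trace: for fixed $\mathcal{O}\in\mathcal{CO}(G)$ let $\psi^{(\mathcal{O})}\colon\mathrm{Bi}(G)\to C_c(G,\mathbb{Q})$ be the $\mathbb{Q}$-linear map with $\psi^{(\mathcal{O})}(gU)=|\mathcal{O}:U|\cdot I_{gU}$ ($I_{gU}$ the characteristic function), and $\mathrm{tr}(x)=\psi^{(\mathcal{O})}(x)(1)\cdot\mu_{\mathcal{O}}\in\mathbf{h}_G$, which is independent of $\mathcal{O}$ and satisfies $\mathrm{tr}(g\cdot x)=\mathrm{tr}(x\cdot g)$. Hattori--Stallings rank: for a finitely generated projective discrete left $\mathbb{Q}[G]$-module $P$, $\mathrm{Hom}_G(P,\mathrm{Bi}(G))$ is a right $\mathbb{Q}[G]$-module via $(\phi\cdot g)(p)=\phi(p)\cdot g$, and there is an isomorphism $\xi_{P,P}\colon\mathrm{Hom}_G(P,\mathrm{Bi}(G))\otimes_{\mathbb{Q}[G]}P\to\mathrm{Hom}_G(P,P)$, $\xi_{P,P}(\phi\otimes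 p)(p')=\theta_P(\phi(p')\otimes p)$. Writing $\xi_{P,P}^{-1}(\mathrm{id}_P)=\sum_i\phi_i\otimes p_i$, one sets $\tilde\rho(P)=\sum_i\mathrm{tr}(\phi_i(p_i))\in\mathbf{h}_G$ (well defined). *)

(* Defs.v *)
From HB Require Import structures.
From mathcomp Require Import all_boot all_order all_algebra finmap.
From mathcomp Require Import all_classical reals ereal topology measure.

Set Implicit Arguments.
Unset Strict Implicit.
Unset Printing Implicit Defensive.

Import Order.TTheory GRing.Theory Num.Theory.

Local Open Scope classical_set_scope.
Local Open Scope ring_scope.

HB.mixin Record isTopologicalGroup G of Group G & Topological G := {
  mulg_continuous : continuous (fun x : G * G => (x.1 * x.2)%g) ;
  invg_continuous : continuous (fun x : G => x^-1%g)
}.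

#[short(type="topologicalGroupType")]
HB.structure Definition TopologicalGroup :=
  {G of isTopologicalGroup G & Group G & Topological G}.

Definition tdlc (G : topologicalGroupType) :=
  [/\ hausdorff_space G, locally_compact [set: G]
    & totally_disconnected [set: G]].

Definition lcoset (G : groupType) (g : G) (A : set G) : set G :=
  [set (g * a)%g | a in A].

Definition rcoset (G : groupType) (A : set G) (g : G) : set G :=
  [set (a * g)%g | a in A].

(** [U ^ g = g^-1 U g] *)
Definition conjs (G : groupType) (A : set G) (g : G) : set G :=
  [set (a ^ g)%g | a in A].

Definition subgroup (G : groupType) (H : set G) :=
  [/\ H 1%g, forall x y, H x -> H y -> H (x * y)%g
    & forall x, H x -> H x^-1%g].

Definition compact_open_subgroup (G : topologicalGroupType) (U : set G) :=
  [/\ subgroup U, compact U & open U].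

Record CO (G : topologicalGroupType) := MkCO {
  CO_set :> set G ;
  COP : compact_open_subgroup CO_set
}.

HB.instance Definition _ G := gen_eqMixin (CO G).
HB.instance Definition _ G := gen_choiceMixin (CO G).

Lemma CO_inj (G : topologicalGroupType) (U V : CO G) :
  CO_set U = CO_set V -> U = V.
Proof.
by case: U V => [U hU] [V hV] /= UV; subst V; congr MkCO; exact: Prop_irrelevance.
Qed.

(** [|H : K|] for a subgroup [K] of finite index in [H]. *)
Definition indexg (G : groupType) (H K : set G) : nat :=
  #|` fset_set [set lcoset x K | x in H] |%N.

(** [|U : V|] for commensurable, not necessarily nested, [U] and [V]. *)
Definition relindex (G : groupType) (U V : set G) : rat :=
  (indexg U (U `&` V))%:R / (indexg V (U `&` V))%:R.

Section TopGroupFacts.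
Variable G : topologicalGroupType.
Implicit Types (g x : G) (A U : set G).

Lemma conjsM A g h : conjs A (g * h)%g = conjs (conjs A g) h.
Proof.
apply/seteqP; split=> [_ [a Aa <-]|_ [_ [a Aa <-] <-]].
  by exists (a ^ g)%g; [exists a|rewrite conjgM].
by exists a => //; rewrite conjgM.
Qed.

Lemma conjs1 A : conjs A 1%g = A.
Proof.
apply/seteqP; split=> [_ [a Aa <-]|a Aa]; first by rewrite conjg1.
by exists a => //; rewrite conjg1.
Qed.

Lemma conjs_preimage A g : conjs A g = (fun x => (x ^ g^-1)%g) @^-1` A.
Proof.
apply/seteqP; split=> [_ [a Aa <-] /=|x /= Ax]; first by rewrite conjgK.
by exists (x ^ g^-1)%g => //; rewrite conjgKV.
Qed.

Lemma mull_continuous g : continuous (fun x : G => (g * x)%g).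
Proof.
move=> x; apply: (@continuous_comp _ _ _ (fun y : G => (g, y))
  (fun y : G * G => (y.1 * y.2)%g)).
  by apply: cvg_pair => /=; [exact: cvg_cst|exact: cvg_id].
exact: mulg_continuous.
Qed.

Lemma mulr_continuous g : continuous (fun x : G => (x * g)%g).
Proof.
move=> x; apply: (@continuous_comp _ _ _ (fun y : G => (y, g))
  (fun y : G * G => (y.1 * y.2)%g)).
  by apply: cvg_pair => /=; [exact: cvg_id|exact: cvg_cst].
exact: mulg_continuous.
Qed.

Lemma conjg_continuous g : continuous (fun x : G => (x ^ g)%g).
Proof.
move=> x; apply: (@continuous_comp _ _ _ (fun y : G => (y * g)%g)
  (fun y : G => (g^-1 * y)%g)).
  exact: mulr_continuous.
exact: mull_continuous.
Qed.

Lemma conjs_compact_open U g :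
  compact_open_subgroup U -> compact_open_subgroup (conjs U g).
Proof.
move=> [[U1 UM UV] Uc Uo]; split.
- split.
  + by exists 1%g => //; rewrite conj1g.
  + move=> _ _ [x Ux <-] [y Uy <-]; exists (x * y)%g; first exact: UM.
    by rewrite conjMg.
  + by move=> _ [x Ux <-]; exists x^-1%g; [exact: UV|rewrite conjVg].
- apply: continuous_compact => //; apply: continuous_subspaceT.
  exact: conjg_continuous.
- rewrite conjs_preimage; apply: open_comp => // x _.
  exact: conjg_continuous.
Qed.

End TopGroupFacts.

Definition conjCO (G : topologicalGroupType) (U : CO G) (g : G) : CO G :=
  MkCO (conjs_compact_open g (COP U)).

(** A left (right) [Q[G]]-module is a rational vector space with a linear left
   (right) action of [G]. *)
HB.mixin Record isLeftGModule (G : groupType) M of GRing.Lmodule rat M := {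
  lact : G -> M -> M ;
  lact_linear : forall g, linear (lact g) ;
  lact1 : forall m, lact 1%g m = m ;
  lactM : forall g h m, lact (g * h)%g m = lact g (lact h m)
}.

#[short(type="leftGModType")]
HB.structure Definition LeftGModule (G : groupType) :=
  {M of isLeftGModule G M & GRing.Lmodule rat M}.

HB.mixin Record isRightGModule (G : groupType) M of GRing.Lmodule rat M := {
  ract : M -> G -> M ;
  ract_linear : forall g, linear (fun m => ract m g) ;
  ract1 : forall m, ract m 1%g = m ;
  ractM : forall g h m, ract m (g * h)%g = ract (ract m g) h
}.

#[short(type="rightGModType")]
HB.structure Definition RightGModule (G : groupType) :=
  {M of isRightGModule G M & GRing.Lmodule rat M}.

Definition equivariant_linear (G : groupType) (M N : leftGModType G)
    (f : M -> N) : Prop :=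
  linear f /\ forall g m, f (lact g m) = lact g (f m).

Definition Hom_pred (G : groupType) (M N : leftGModType G) :
  {pred M -> N} := fun f => `[< equivariant_linear f >].

Definition Hom (G : groupType) (M N : leftGModType G) :=
  {f : M -> N | Hom_pred f}.

Section HomModule.
Variables (G : groupType) (M N : leftGModType G).

Lemma lactZ (g : G) (a : rat) (m : M) : lact g (a *: m) = a *: lact g m.
Proof.
have L := @lact_linear G M g.
have L0 : lact g (0 : M) = 0.
  by have := L (-1) 0 0; rewrite scaleN1r addNr scaleN1r addNr.
by have := L a m 0; rewrite !addr0 L0 addr0.
Qed.

Lemma Hom_submod : submod_closed (@Hom_pred G M N).
Proof.
split=> [|a u v /asboolP[uL uG] /asboolP[vL vG]]; apply/asboolP; split.
- by move=> a x y; rewrite scaler0 addr0.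
- move=> g m /=; have := @lact_linear G N g (-1) 0 0.
  by rewrite scaleN1r addNr scaleN1r addNr.
- move=> b x y.
  transitivity (a *: u (b *: x + y) + v (b *: x + y)); first by [].
  rewrite uL vL !scalerDr scalerA [a * b]mulrC -scalerA addrACA -scalerDr.
  by [].
- move=> g m; transitivity (a *: u (lact g m) + v (lact g m)); first by [].
  by rewrite uG vG -lact_linear.
Qed.

HB.instance Definition _ :=
  GRing.isSubmodClosed.Build rat (M -> N) (@Hom_pred G M N) Hom_submod.
HB.instance Definition _ := SubType.on (Hom M N).
HB.instance Definition _ := [Choice of Hom M N by <:].
HB.instance Definition _ := [SubChoice_isSubLmodule of Hom M N by <:].

End HomModule.

(** [freeQ X] is the rational vector space with basis [X]: finitely supported
   functions, the basis vectors being [delta x]. *)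
Definition finsupp_pred (X : choiceType) : {pred X -> rat^o} :=
  fun f => `[< finite_set [set x | f x != 0] >].

Definition freeQ (X : choiceType) := {f : X -> rat^o | finsupp_pred f}.

Section FreeModule.
Variable X : choiceType.

Lemma finsupp_submod : submod_closed (@finsupp_pred X).
Proof.
split=> [|a u v /asboolP fu /asboolP fv]; apply/asboolP.
- rewrite [X in finite_set X](_ : _ = set0) ?finite_set0//.
  by apply/seteqP; split=> x //=; rewrite /GRing.zero /= eqxx.
- have fuv : finite_set ([set x | u x != 0] `|` [set x | v x != 0]).
    by rewrite finite_setU.
  apply: sub_finite_set fuv => x /=.
  rewrite -[_ x]/(a * u x + v x); case: (eqVneq (u x) 0) => [-> |]; last by left.
  by rewrite mulr0 add0r; right.
Qed.

HB.instance Definition _ :=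
  GRing.isSubmodClosed.Build rat (X -> rat^o) (@finsupp_pred X) finsupp_submod.
HB.instance Definition _ := SubType.on (freeQ X).
HB.instance Definition _ := [Choice of freeQ X by <:].
HB.instance Definition _ := [SubChoice_isSubLmodule of freeQ X by <:].

Lemma delta_subproof (x : X) : finsupp_pred (fun y => (x == y)%:R : rat^o).
Proof.
apply/asboolP; apply: sub_finite_set (finite_set1 x) => y /=.
by case: (eqVneq x y) => [->|_]; rewrite ?eqxx.
Qed.

Definition delta (x : X) : freeQ X :=
  exist (fun f => finsupp_pred f) _ (delta_subproof x).

(** Linear extension of a map defined on the basis. *)
Definition lext (V : lmodType rat) (F : X -> V) (f : freeQ X) : V :=
  \sum_(x \in [set: X]) sval f x *: F x.

Lemma freeQP (f g : freeQ X) : (forall x, sval f x = sval g x) -> f = g.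
Proof. by move=> fg; apply: val_inj; apply/funext. Qed.

Lemma freeQD (a : rat) (f g : freeQ X) x :
  sval (a *: f + g) x = a * sval f x + sval g x.
Proof. by []. Qed.

Definition fsupp (f : freeQ X) : {fset X} := fset_set [set x | sval f x != 0].

Lemma fsuppP (f : freeQ X) x : (x \in fsupp f) = (sval f x != 0).
Proof.
rewrite /fsupp in_fset_set; last by case: f => f /= /asboolP.
by apply/idP/idP; rewrite inE.
Qed.

Lemma lextE (V : lmodType rat) (F : X -> V) (A : {fset X}) (f : freeQ X) :
  (fsupp f `<=` A)%fset -> lext F f = \sum_(x <- A) sval f x *: F x.
Proof.
move=> fA; rewrite /lext (fsbigTE A)// => x xA.
have : x \notin fsupp f by apply: contra xA; exact: (fsubsetP fA).
by rewrite fsuppP negbK => /eqP ->; rewrite scale0r.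
Qed.

Lemma lext_linear (V : lmodType rat) (F : X -> V) : linear (lext F).
Proof.
move=> a f g; pose A := (fsupp f `|` fsupp g `|` fsupp (a *: f + g)%R)%fset.
have [fA gA hA] : [/\ fsupp f `<=` A, fsupp g `<=` A
    & fsupp (a *: f + g)%R `<=` A]%fset.
  by split; apply/fsubsetP => x; rewrite /A !in_fsetU => ->; rewrite ?orbT.
rewrite (lextE _ fA) (lextE _ gA) (lextE _ hA).
rewrite scaler_sumr -big_split /=; apply: eq_bigr => x _.
by rewrite scalerA -scalerDl.
Qed.

Lemma lext_delta (V : lmodType rat) (F : X -> V) x : lext F (delta x) = F x.
Proof.
rewrite (@lextE _ _ [fset x]%fset); last first.
  apply/fsubsetP => y; rewrite fsuppP in_fset1 /=.
  by rewrite (eq_sym x); case: (y == x) => //; rewrite eqxx.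
rewrite big_seq_fset1.
have -> : sval (delta x) x = 1. by rewrite /= eqxx.
by rewrite scale1r.
Qed.

End FreeModule.

Section LinearFacts.
Variables (V W : lmodType rat) (f : V -> W).
Hypothesis f_lin : linear f.

Lemma lin0 : f 0 = 0.
Proof. by have := f_lin (-1) 0 0; rewrite scaleN1r addNr scaleN1r addNr. Qed.

Lemma linD u v : f (u + v) = f u + f v.
Proof. by have := f_lin 1 u v; rewrite !scale1r. Qed.

Lemma linZ a u : f (a *: u) = a *: f u.
Proof. by have := f_lin a u 0; rewrite lin0 !addr0. Qed.

Lemma linB u v : f (u - v) = f u - f v.
Proof. by rewrite -scaleN1r linD linZ scaleN1r. Qed.

Lemma lin_sum (I : Type) (r : seq I) (F : I -> V) :
  f (\sum_(i <- r) F i) = \sum_(i <- r) f (F i).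
Proof. by elim/big_ind2: _ => //; [exact: lin0|move=> ? ? ? ? <- <-; exact: linD]. Qed.

Lemma lin_fsum (I : choiceType) (A : set I) (F : I -> V) : injective f ->
  f (\sum_(i \in A) F i) = \sum_(i \in A) f (F i).
Proof.
move=> f_inj; rewrite lin_sum; congr bigop.
rewrite /finite_support !unlock; congr (finmap.enum_fset (fset_set _)).
apply/seteqP; split=> i [Ai /= Fi]; split => //=; apply: contra_not Fi.
  by move=> /= fF0; apply: f_inj; rewrite lin0.
by move=> ->; exact: lin0.
Qed.

End LinearFacts.

Lemma lin_reindex (V : lmodType rat) (I J : choiceType) (h : I -> J)
    (A : set I) (B : set J) (F : J -> V) : set_bij A B h ->
  \sum_(j \in B) F j = \sum_(i \in A) F (h i).
Proof. exact: reindex_fsbig. Qed.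

Lemma freeQ_ind_lin (X : choiceType) (V : lmodType rat) (f g : freeQ X -> V) :
  linear f -> linear g -> (forall x, f (delta x) = g (delta x)) -> f =1 g.
Proof.
move=> fL gL fg u.
have -> : u = \sum_(x <- fsupp u) sval u x *: delta x.
  rewrite -(@lextE _ _ (@delta X))//; apply: freeQP => y.
  pose ev (w : freeQ X) : rat^o := sval w y.
  have evL : linear ev by [].
  rewrite -/(ev u) -/(ev (lext _ _)) (lextE _ (fsubset_refl _)) (lin_sum evL).
  transitivity (\sum_(x <- fsupp u) sval u x *: ((x == y)%:R : rat^o)); last first.
    by apply: eq_bigr => x _; rewrite (linZ evL).
  case: (boolP (y \in fsupp u)) => yu.
    rewrite (big_fsetD1 y)//= eqxx [_ *: _]mulr1 big1_fset ?addr0// => x.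
    by rewrite !inE => /andP[/negPf -> _] _; rewrite [LHS]mulr0.
  rewrite big1_fset; last first.
    move=> x xu _; case: (eqVneq x y) => [xy|]; last by rewrite [LHS]mulr0.
    by rewrite xy (negPf yu) in xu.
  by apply/eqP; move: yu; rewrite fsuppP negbK.
rewrite (lin_sum fL) (lin_sum gL); apply: eq_bigr => x _.
by rewrite (linZ fL) (linZ gL) fg.
Qed.

(** [lquot R] is the quotient of [V] by the subspace spanned by [R]. *)
Definition span (V : lmodType rat) (R : set V) : set V :=
  [set v | forall S : {pred V}, submod_closed S ->
    (forall r, R r -> r \in S) -> v \in S].

Definition span_pred (V : lmodType rat) (R : set V) : {pred V} :=
  fun v => `[< span R v >].

Section LinearQuotient.
Variables (V : lmodType rat) (R : set V).

Lemma span_submod : submod_closed (span_pred R).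
Proof.
split=> [|a u v /asboolP su /asboolP sv]; apply/asboolP => S hS RS.
  exact: hS.1.
by apply: hS.2; [exact: su|exact: sv].
Qed.

Lemma span_sub r : R r -> r \in span_pred R.
Proof. by move=> Rr; apply/asboolP => S _; exact. Qed.

Lemma span_min (S : {pred V}) : submod_closed S ->
  (forall r, R r -> r \in S) -> forall v, v \in span_pred R -> v \in S.
Proof. by move=> hS RS v /asboolP; exact. Qed.

HB.instance Definition _ :=
  GRing.isSubmodClosed.Build rat V (span_pred R) span_submod.

Definition lquot := Quotient.quot (span_pred R : zmodClosed V).

HB.instance Definition _ := GRing.Zmodule.on lquot.

Definition lpi (v : V) : lquot := \pi_(Quotient.quot (span_pred R : zmodClosed V))%qT v.

Definition lrepr (q : lquot) : V := repr (q : Quotient.quot _).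

Lemma lreprK q : lpi (lrepr q) = q.
Proof. exact: reprK. Qed.

Lemma lpiP u v : lpi u = lpi v <-> (u - v) \in span_pred R.
Proof.
rewrite (@Quotient.idealrBE V (span_pred R : zmodClosed V) u v).
by split=> [e|/eqP//]; apply/eqP; exact: e.
Qed.

Lemma lpiD u v : lpi (u + v) = lpi u + lpi v.
Proof. exact: (raddfD (\pi_(Quotient.quot (span_pred R : zmodClosed V))%qT)). Qed.

Lemma lpi_repr u : (u - lrepr (lpi u)) \in span_pred R.
Proof. by apply/lpiP; rewrite lreprK. Qed.

Definition lquot_scale (a : rat) (q : lquot) : lquot := lpi (a *: lrepr q).

Lemma lpiZ a u : lpi (a *: u) = lquot_scale a (lpi u).
Proof. by apply/lpiP; rewrite -scalerBr rpredZ// lpi_repr. Qed.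

Lemma lquot_scaleA a b q :
  lquot_scale a (lquot_scale b q) = lquot_scale (a * b) q.
Proof. by rewrite -[q]lreprK -!lpiZ scalerA. Qed.

Lemma lquot_scale1 : left_id 1 lquot_scale.
Proof. by move=> q; rewrite -[q]lreprK -!lpiZ scale1r. Qed.

Lemma lquot_scaleDr : right_distributive lquot_scale +%R.
Proof.
move=> a p q; rewrite -[p]lreprK -[q]lreprK -lpiD -!lpiZ -lpiD.
by rewrite scalerDr.
Qed.

Lemma lquot_scaleDl q : {morph lquot_scale^~ q : a b / a + b}.
Proof. by move=> a b; rewrite -[q]lreprK -!lpiZ -lpiD scalerDl. Qed.

HB.instance Definition _ := GRing.Zmodule_isLmodule.Build rat lquot
  lquot_scaleA lquot_scale1 lquot_scaleDr lquot_scaleDl.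

Lemma lpi_linear : linear lpi.
Proof. by move=> a u v; rewrite lpiD lpiZ. Qed.

(** The map induced on [lquot R] by a linear [f] killing [R]: [qliftE] shows that
   its value does not depend on the representative. *)
Definition qlift (W : Type) (f : V -> W) (q : lquot) : W := f (lrepr q).

Lemma qliftE (W : lmodType rat) (f : V -> W) : linear f ->
  (forall r, R r -> f r = 0) -> forall v, qlift f (lpi v) = f v.
Proof.
move=> fL fR v.
pose S : {pred V} := fun w => f w == 0.
have hS : submod_closed S.
  split=> [|a u w /eqP fu /eqP fw]; rewrite /S /in_mem /= ?(lin0 fL)//.
  by rewrite fL fu fw scaler0 addr0.
have /eqP := span_min hS (fun r Rr => introT eqP (fR r Rr)) (lpi_repr v).
by rewrite (linB fL) => /subr0_eq ->.
Qed.

Lemma qlift_linear (W : lmodType rat) (f : V -> W) : linear f ->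
  (forall r, R r -> f r = 0) -> linear (qlift f).
Proof.
move=> fL fR a p q; rewrite -[p]lreprK -[q]lreprK -lpi_linear !qliftE//.
exact: fL.
Qed.

End LinearQuotient.

Definition cosets_pred (G : groupType) (U : set G) : {pred set G} :=
  fun C => `[< exists g, C = lcoset g U >].

Definition cosets (G : groupType) (U : set G) := {C : set G | cosets_pred U C}.

HB.instance Definition _ (G : groupType) (U : set G) :=
  SubType.on (cosets U).
HB.instance Definition _ (G : groupType) (U : set G) :=
  [Choice of cosets U by <:].

Definition cosets_sum (G : groupType) (I : choiceType) (U : I -> set G) :=
  {i : I & cosets (U i)}.

HB.instance Definition _ (G : groupType) (I : choiceType) (U : I -> set G) :=
  Choice.copy (cosets_sum U) {i : I & cosets (U i)}.

Section CosetTranslation.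
Variable G : groupType.
Implicit Types (g h : G) (A U : set G).

Lemma lcosetM g h A : lcoset (g * h)%g A = lcoset g (lcoset h A).
Proof.
apply/seteqP; split=> [_ [a Aa <-]|_ [_ [a Aa <-] <-]].
  by exists (h * a)%g; [exists a|rewrite mulgA].
by exists a => //; rewrite mulgA.
Qed.

Lemma lcoset1 A : lcoset 1%g A = A.
Proof.
apply/seteqP; split=> [_ [a Aa <-]|a Aa]; first by rewrite mul1g.
by exists a => //; rewrite mul1g.
Qed.

Lemma rcosetM A g h : rcoset A (g * h)%g = rcoset (rcoset A g) h.
Proof.
apply/seteqP; split=> [_ [a Aa <-]|_ [_ [a Aa <-] <-]].
  by exists (a * g)%g; [exists a|rewrite mulgA].
by exists a => //; rewrite mulgA.
Qed.

Lemma rcoset1 A : rcoset A 1%g = A.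
Proof.
apply/seteqP; split=> [_ [a Aa <-]|a Aa]; first by rewrite mulg1.
by exists a => //; rewrite mulg1.
Qed.

Lemma lrcoset g A h : rcoset (lcoset g A) h = lcoset g (rcoset A h).
Proof.
apply/seteqP; split=> [_ [_ [a Aa <-] <-]|_ [_ [a Aa <-] <-]].
  by exists (a * h)%g; [exists a|rewrite mulgA].
by exists (g * a)%g; [exists a|rewrite mulgA].
Qed.

Lemma lcosetS g A B : (lcoset g A `<=` lcoset g B) = (A `<=` B).
Proof.
apply/propext; split=> AB; last by move=> _ [a Aa <-]; exists a => //; exact: AB.
by move=> a Aa; have [|b Bb /mulgI <-] := AB (g * a)%g; first by exists a.
Qed.

Lemma rcosetS g A B : (rcoset A g `<=` rcoset B g) = (A `<=` B).
Proof.
apply/propext; split=> AB; last by move=> _ [a Aa <-]; exists a => //; exact: AB.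
by move=> a Aa; have [|b Bb /mulIg <-] := AB (a * g)%g; first by exists a.
Qed.

Lemma lcoset_cosets g U (C : cosets U) : cosets_pred U (lcoset g (sval C)).
Proof.
case: C => C /= /asboolP[h ->]; apply/asboolP; exists (g * h)%g.
by rewrite lcosetM.
Qed.

Lemma rcoset_cosets g U (C : cosets U) :
  cosets_pred (conjs U g) (rcoset (sval C) g).
Proof.
case: C => C /= /asboolP[h ->]; apply/asboolP; exists (h * g)%g.
apply/seteqP; split=> [_ [_ [u Uu <-] <-]|_ [_ [u Uu <-] <-]].
  exists (u ^ g)%g; first by exists u.
  by rewrite -!mulgA -conjgC.
exists (h * u)%g; first by exists u.
by rewrite -!mulgA -conjgC.
Qed.

(** [gU |-> hgU] on [G/U]. *)
Definition cosets_lmul (h : G) U (C : cosets U) : cosets U :=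
  exist (fun D => cosets_pred U D) _ (lcoset_cosets h C).

(** [xU |-> xgU^g], from [G/U] to [G/U^g]. *)
Definition cosets_rmul U (C : cosets U) (g : G) : cosets (conjs U g) :=
  exist (fun D => cosets_pred (conjs U g) D) _ (rcoset_cosets g C).

Lemma cosets_eq U (C D : cosets U) : sval C = sval D -> C = D.
Proof. exact: val_inj. Qed.

End CosetTranslation.

(** [permQ U] is the direct sum of the permutation modules [Q[G/U_i]], realised
   as the vector space whose basis is the disjoint union of the [G/U_i]. *)
Definition permQ (G : groupType) (I : choiceType) (U : I -> set G) :=
  freeQ (cosets_sum U).

HB.instance Definition _ (G : groupType) (I : choiceType) (U : I -> set G) :=
  GRing.Lmodule.on (permQ U).

Section PermModule.
Variables (G : groupType) (I : choiceType) (U : I -> set G).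

Definition cosets_sum_lmul (g : G) (x : cosets_sum U) : cosets_sum U :=
  Tagged (fun i => cosets (U i)) (cosets_lmul g (tagged x)).

Definition permQ_lact (g : G) : permQ U -> permQ U :=
  lext (fun x => delta (cosets_sum_lmul g x)).

Lemma permQ_lact_linear g : linear (permQ_lact g).
Proof. exact: lext_linear. Qed.

Lemma permQ_lact_delta g x :
  permQ_lact g (delta x) = delta (cosets_sum_lmul g x).
Proof. exact: lext_delta. Qed.

Lemma permQ_lact1 m : permQ_lact 1%g m = m.
Proof.
apply: (freeQ_ind_lin (permQ_lact_linear 1%g) (g := id)) => // x.
rewrite permQ_lact_delta; congr delta; case: x => i C.
by rewrite /cosets_sum_lmul; congr Tagged; apply: cosets_eq; rewrite /= lcoset1.
Qed.

Lemma permQ_lactM g h m :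
  permQ_lact (g * h)%g m = permQ_lact g (permQ_lact h m).
Proof.
apply: (freeQ_ind_lin (permQ_lact_linear _)
  (g := fun m => permQ_lact g (permQ_lact h m))) => [a u v|x].
  by rewrite !permQ_lact_linear.
rewrite !permQ_lact_delta; congr delta; case: x => i C.
by rewrite /cosets_sum_lmul; congr Tagged; apply: cosets_eq; rewrite /= lcosetM.
Qed.

HB.instance Definition _ := isLeftGModule.Build G (permQ U)
  permQ_lact_linear permQ_lact1 permQ_lactM.

End PermModule.

Section Discrete.
Variable G : topologicalGroupType.

Definition stabilizer (M : leftGModType G) (m : M) : set G :=
  [set g | lact g m = m].

Definition discrete (M : leftGModType G) := forall m : M, open (stabilizer m).

Definition projective (P : leftGModType G) :=
  discrete P /\
  forall (A B : leftGModType G) (f : Hom A B) (p : Hom P B),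
    discrete A -> discrete B -> (forall b, exists a, sval f a = b) ->
    exists q : Hom P A, forall x, sval f (sval q x) = sval p x.

Definition finitely_generated (M : leftGModType G) :=
  exists (n : nat) (U : 'I_n -> CO G) (f : Hom (permQ (fun i => U i : set G)) M),
    forall m, exists x, sval f x = m.

End Discrete.

Section StandardBimodule.
Variable G : topologicalGroupType.

(** The direct sum of all [Q[G/U]]. *)
Definition preBi := permQ (fun U : CO G => U : set G).

(** The coset [C] of [U], as an element of the summand [Q[G/U]]. *)
Definition bcoset (U : CO G) (C : cosets U) : preBi :=
  delta (Tagged (fun U : CO G => cosets (U : set G)) C).

(** [gU |-> |U : V|^-1 \sum_r grV]; the [grV], with [r] over representatives of
   [U/V], are the left cosets of [V] contained in [gU]. *)
Definition transition (U V : CO G) (C : cosets U) : preBi :=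
  (relindex U V)^-1 *:
    \sum_(D \in [set D : cosets V | sval D `<=` sval C]) bcoset D.

Definition bi_rel : set preBi :=
  [set z | exists (U V : CO G) (C : cosets U),
    V `<=` U /\ z = bcoset C - transition V C].

(** The direct limit of the [Q[G/U]]. *)
Definition Bi := lquot bi_rel.

HB.instance Definition _ := GRing.Lmodule.on Bi.

Definition bi_lact (g : G) : Bi -> Bi := qlift (fun z => lpi bi_rel (lact g z)).

Definition cosets_sum_rmul (x : cosets_sum (fun U : CO G => U : set G)) (g : G) :
  cosets_sum (fun U : CO G => U : set G) :=
  @Tagged _ (conjCO (tag x) g) (fun U : CO G => cosets (U : set G))
    (cosets_rmul (tagged x) g).

Definition preBi_ract (z : preBi) (g : G) : preBi :=
  lext (fun x => delta (cosets_sum_rmul x g)) z.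

Definition bi_ract (b : Bi) (g : G) : Bi :=
  qlift (fun z => lpi bi_rel (preBi_ract z g)) b.

Lemma cosets_sum_eq (x y : cosets_sum (fun U : CO G => U : set G)) :
  (tag x : set G) = tag y -> sval (tagged x) = sval (tagged y) -> x = y.
Proof.
case: x y => [U C] [V D] /= /CO_inj UV; subst V => CD.
by congr Tagged; exact: cosets_eq.
Qed.

Lemma lact_bcoset g (U : CO G) (C : cosets U) :
  lact g (bcoset C) = bcoset (cosets_lmul g C).
Proof. exact: permQ_lact_delta. Qed.

Lemma ract_bcoset g (U : CO G) (C : cosets U) :
  preBi_ract (bcoset C) g = bcoset (cosets_rmul C g : cosets (conjCO U g)).
Proof. exact: lext_delta. Qed.

Lemma lact_preBi_inj g : injective (lact g : preBi -> preBi).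
Proof. by move=> u v /(congr1 (lact g^-1%g)); rewrite -!lactM mulVg !lact1. Qed.

Lemma lact_transition g (U V : CO G) (C : cosets U) :
  lact g (transition V C) = transition V (cosets_lmul g C).
Proof.
have gL : linear (lact g : preBi -> preBi) by exact: lact_linear.
rewrite /transition (linZ gL) (lin_fsum gL _ _ (@lact_preBi_inj g)).
under eq_fsbigr do rewrite lact_bcoset.
congr (_ *: _); apply/esym; apply: (@lin_reindex preBi _ _ (fun D : cosets V => cosets_lmul g D)
  [set D : cosets V | sval D `<=` sval C]
  [set D : cosets V | sval D `<=` sval (cosets_lmul g C)]
  (fun D : cosets V => bcoset D)).
split=> [D /= DC|D E _ _ /(congr1 sval) /= DE|D /= DC].
- by rewrite lcosetS.
- apply: cosets_eq; move/(congr1 (lcoset g^-1%g)): DE.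
  by rewrite -!lcosetM mulVg !lcoset1.
- have gD : cosets_lmul g (cosets_lmul g^-1%g D) = D.
    by apply: cosets_eq; rewrite /= -lcosetM mulgV lcoset1.
  by exists (cosets_lmul g^-1%g D); rewrite //= -(lcosetS g) -lcosetM mulgV lcoset1.
Qed.

Lemma bi_lact_rel g r : bi_rel r -> lpi bi_rel (lact g r) = 0.
Proof.
move=> [U [V [C [VU ->]]]]; rewrite -[0]/(0 : lquot _) -(lin0 (@lpi_linear _ bi_rel)).
apply/lpiP; rewrite subr0 (linB (@lact_linear G preBi g)) lact_bcoset.
rewrite lact_transition; apply: span_sub.
by exists U, V, (cosets_lmul g C).
Qed.

Lemma bi_lact_prelinear g :
  linear (fun z : preBi => lpi bi_rel (lact g z)).
Proof. by move=> a u v; rewrite lact_linear lpi_linear. Qed.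

Lemma bi_lactE g z : bi_lact g (lpi bi_rel z) = lpi bi_rel (lact g z).
Proof. by apply: (qliftE (bi_lact_prelinear g)); exact: bi_lact_rel. Qed.

Lemma bi_lact_linear g : linear (bi_lact g).
Proof. by apply: (qlift_linear (bi_lact_prelinear g)); exact: bi_lact_rel. Qed.

Lemma bi_lact1 b : bi_lact 1%g b = b.
Proof. by rewrite -[b]lreprK bi_lactE lact1. Qed.

Lemma bi_lactM g h b : bi_lact (g * h)%g b = bi_lact g (bi_lact h b).
Proof. by rewrite -[b]lreprK !bi_lactE lactM. Qed.

HB.instance Definition _ := isLeftGModule.Build G Bi
  bi_lact_linear bi_lact1 bi_lactM.

Lemma preBi_ract_linear g : linear (preBi_ract ^~ g).
Proof. exact: lext_linear. Qed.

Lemma preBi_ract1 z : preBi_ract z 1%g = z.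
Proof.
apply: (freeQ_ind_lin (preBi_ract_linear 1%g) (g := id)) => // x.
rewrite /preBi_ract lext_delta; congr delta.
by apply: cosets_sum_eq; rewrite /= ?conjs1 ?rcoset1.
Qed.

Lemma preBi_ractM g h z :
  preBi_ract z (g * h)%g = preBi_ract (preBi_ract z g) h.
Proof.
apply: (freeQ_ind_lin (preBi_ract_linear (g * h)%g)
  (g := fun m => preBi_ract (preBi_ract m g) h)) => [a u v|x].
  by rewrite !preBi_ract_linear.
rewrite /preBi_ract !lext_delta; congr delta.
by apply: cosets_sum_eq; rewrite /= ?conjsM ?rcosetM.
Qed.

Lemma preBi_ract_inj g : injective (preBi_ract ^~ g).
Proof.
move=> u v /(congr1 (preBi_ract ^~ g^-1%g)) /=.
by rewrite -!preBi_ractM mulgV !preBi_ract1.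
Qed.

Lemma preBi_lract g h z :
  preBi_ract (lact g z) h = lact g (preBi_ract z h).
Proof.
apply: (freeQ_ind_lin (f := fun z : preBi => preBi_ract (lact g z) h)
  (g := fun z : preBi => lact g (preBi_ract z h))) => [a u v|a u v|x].
- by rewrite lact_linear preBi_ract_linear.
- by rewrite preBi_ract_linear lact_linear.
have lD y : lact g (delta y : preBi) = delta (cosets_sum_lmul g y).
  exact: permQ_lact_delta.
rewrite lD /preBi_ract !lext_delta lD; congr delta.
by apply: cosets_sum_eq; rewrite //= lrcoset.
Qed.

Lemma indexg_conjs (H K : set G) g : indexg (conjs H g) (conjs K g) = indexg H K.
Proof.
pose f (A : set G) := conjs A g.
have f_inj : injective f.
  by move=> A B /(congr1 (fun C : set G => conjs C g^-1%g)); rewrite /f /= -!conjsM mulgV !conjs1.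
have E : [set lcoset x (conjs K g) | x in conjs H g] =
         f @` [set lcoset x K | x in H].
  have L x : lcoset (x ^ g)%g (conjs K g) = f (lcoset x K).
    apply/seteqP; split=> [_ [_ [k Kk <-] <-]|_ [_ [k Kk <-] <-]].
      by exists (x * k)%g; [exists k|rewrite conjMg].
    by exists (k ^ g)%g; [exists k|rewrite conjMg].
  apply/seteqP; split=> [_ [_ [x Hx <-] <-]|_ [_ [x Hx <-] <-]].
    by rewrite L; exists (lcoset x K) => //; exists x.
  by exists (x ^ g)%g; [exists x|rewrite L].
rewrite /indexg E; have [fin|inf] := pselect (finite_set [set lcoset x K | x in H]).
  by rewrite fset_set_image// card_imfset.
rewrite [in RHS]/fset_set; case: pselect => // _.
rewrite /fset_set; case: pselect => // fin; case: inf.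
have -> : [set lcoset x K | x in H] =
    (fun C : set G => conjs C g^-1%g) @` (f @` [set lcoset x K | x in H]).
  have fK (A : set G) : conjs (f A) g^-1%g = A by rewrite /f -conjsM mulgV conjs1.
  apply/seteqP; split=> [A SA|_ [_ [A SA <-] <-]]; last by rewrite fK.
  by exists (f A); [exists A|rewrite fK].
exact: finite_image.
Qed.

Lemma relindex_conjs (U V : set G) g :
  relindex (conjs U g) (conjs V g) = relindex U V.
Proof.
have I : conjs U g `&` conjs V g = conjs (U `&` V) g by rewrite !conjs_preimage.
by rewrite /relindex I !indexg_conjs.
Qed.

Lemma ract_transition g (U V : CO G) (C : cosets U) :
  preBi_ract (transition V C) g =
  transition (conjCO V g) (cosets_rmul C g : cosets (conjCO U g)).
Proof.
rewrite /transition (linZ (preBi_ract_linear g)).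
rewrite (lin_fsum (preBi_ract_linear g) _ _ (@preBi_ract_inj g)).
under eq_fsbigr do rewrite ract_bcoset.
rewrite /= relindex_conjs; congr (_ *: _); apply/esym.
apply: (@lin_reindex preBi _ _ (fun D : cosets V =>
  cosets_rmul D g : cosets (conjCO V g))
  [set D : cosets V | sval D `<=` sval C]
  [set D : cosets (conjCO V g) | sval D `<=` sval (cosets_rmul C g)]
  (fun D : cosets (conjCO V g) => bcoset D)).
split=> [D /= DC|D E _ _ /(congr1 sval) /= DE|D /= DC].
- by rewrite rcosetS.
- apply: cosets_eq; move/(congr1 (fun B : set G => rcoset B g^-1%g)): DE.
  by rewrite /= -!rcosetM mulgV !rcoset1.
- have hD : cosets_pred V (rcoset (sval D) g^-1%g).
    have := rcoset_cosets g^-1%g D.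
    by rewrite -conjsM mulgV conjs1.
  exists (exist (fun E => cosets_pred V E) _ hD) => /=.
    by rewrite -(rcosetS g) -rcosetM mulVg rcoset1.
  by apply: cosets_eq; rewrite /= -rcosetM mulVg rcoset1.
Qed.

Lemma bi_ract_rel g r : bi_rel r -> lpi bi_rel (preBi_ract r g) = 0.
Proof.
move=> [U [V [C [VU ->]]]]; rewrite -[0]/(0 : lquot _) -(lin0 (@lpi_linear _ bi_rel)).
apply/lpiP; rewrite subr0 (linB (preBi_ract_linear g)) ract_bcoset.
rewrite ract_transition; apply: span_sub.
exists (conjCO U g), (conjCO V g), (cosets_rmul C g); split=> //.
by move=> _ [v Vv <-]; exists v => //; exact: VU.
Qed.

Lemma bi_ract_prelinear g :
  linear (fun z : preBi => lpi bi_rel (preBi_ract z g)).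
Proof. by move=> a u v; rewrite preBi_ract_linear lpi_linear. Qed.

Lemma bi_ractE g z : bi_ract (lpi bi_rel z) g = lpi bi_rel (preBi_ract z g).
Proof. by apply: (qliftE (bi_ract_prelinear g)); exact: bi_ract_rel. Qed.

Lemma bi_ract_linear g : linear (bi_ract ^~ g).
Proof. by apply: (qlift_linear (bi_ract_prelinear g)); exact: bi_ract_rel. Qed.

Lemma bi_ract1 b : bi_ract b 1%g = b.
Proof. by rewrite -[b]lreprK bi_ractE preBi_ract1. Qed.

Lemma bi_ractM g h b : bi_ract b (g * h)%g = bi_ract (bi_ract b g) h.
Proof. by rewrite -[b]lreprK !bi_ractE preBi_ractM. Qed.

HB.instance Definition _ := isRightGModule.Build G Bi
  bi_ract_linear bi_ract1 bi_ractM.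

Lemma bi_lract g h (b : Bi) : ract (lact g b) h = lact g (ract b h).
Proof.
rewrite -[b]lreprK -[LHS]/(bi_ract (bi_lact g _) h).
rewrite -[RHS]/(bi_lact g (bi_ract _ h)).
by rewrite bi_lactE !bi_ractE bi_lactE preBi_lract.
Qed.

(** [Hom_G(M, Bi(G))] with [(f g)(m) = f(m) g]. *)
Section HomBi.
Variable M : leftGModType G.

Lemma hom_ract_subproof (f : Hom M Bi) (g : G) :
  @Hom_pred G M Bi (fun m => ract (sval f m) g).
Proof.
case: f => f /= /asboolP[fL fG]; apply/asboolP; split=> [a u v|h m].
  by rewrite fL ract_linear.
by rewrite fG bi_lract.
Qed.

Definition hom_ract (f : Hom M Bi) (g : G) : Hom M Bi :=
  exist (fun f => @Hom_pred G M Bi f) _ (hom_ract_subproof f g).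

Lemma hom_ract_linear g : linear (hom_ract ^~ g).
Proof.
move=> a f h; apply: val_inj; apply/funext => m /=.
exact: (@ract_linear G Bi g a (sval f m) (sval h m)).
Qed.

Lemma hom_ract1 f : hom_ract f 1%g = f.
Proof. by apply: val_inj; apply/funext => m /=; rewrite ract1. Qed.

Lemma hom_ractM g h f : hom_ract f (g * h)%g = hom_ract (hom_ract f g) h.
Proof. by apply: val_inj; apply/funext => m /=; rewrite ractM. Qed.

HB.instance Definition _ := isRightGModule.Build G (Hom M Bi)
  hom_ract_linear hom_ract1 hom_ractM.

End HomBi.

End StandardBimodule.

Section Tensor.
Variables (G : groupType) (N : rightGModType G) (M : leftGModType G).

Definition tensor_rel : set (freeQ (N * M)%type) :=
  [set z | [\/ exists (a : rat) (n n' : N) (m : M),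
                 z = delta (a *: n + n', m) - (a *: delta (n, m) + delta (n', m)),
               exists (a : rat) (n : N) (m m' : M),
                 z = delta (n, a *: m + m') - (a *: delta (n, m) + delta (n, m'))
             | exists (n : N) (g : G) (m : M),
                 z = delta (ract n g, m) - delta (n, lact g m)]].

Definition tensor := lquot tensor_rel.

HB.instance Definition _ := GRing.Lmodule.on tensor.

Definition tens (n : N) (m : M) : tensor := lpi tensor_rel (delta (n, m)).

End Tensor.

(** The maps [theta_bi], [theta], [xi] and [psi] below are induced on quotients
   through [qlift]; for the first three this requires the module to be discrete. *)
Section Theta.
Variables (G : topologicalGroupType) (M : leftGModType G).

(** [|U : W|^-1 \sum_r gr m], with [r] over representatives of [U/W] where
   [W = U `&` G_m].  The left cosets of [W] contained in [C = gU] are the [grW],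
   and all elements of [grW] act on [m] as [gr]. *)
Definition theta_coset (U : CO G) (C : cosets U) (m : M) : M :=
  let W := U `&` stabilizer m in
  (indexg U W)%:R^-1 *:
    \sum_(D \in [set lcoset x W | x in sval C]) lact (xget 1%g D) m.

Definition theta_bi (b : Bi G) (m : M) : M :=
  qlift (lext (fun x => theta_coset (tagged x) m)) b.

Definition theta : tensor (Bi G) M -> M :=
  qlift (lext (fun x => theta_bi x.1 x.2)).

End Theta.

Section Xi.
Variables (G : topologicalGroupType) (P : leftGModType G).

(** [xi] takes its values in the subspace [Hom_G(P, P)] of [P -> P]. *)
Definition xi : tensor (Hom P (Bi G)) P -> (P -> P) :=
  qlift (lext (fun x => fun p' => theta (tens (sval x.1 p') x.2))).

End Xi.

(** [psi] takes its values in [C_c(G, Q)]. *)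
Definition psi (G : topologicalGroupType) (O : CO G) : Bi G -> (G -> rat^o) :=
  qlift (lext (fun x : cosets_sum (fun U : CO G => U : set G) =>
    relindex O (tag x) *: (fun g : G => (g \in sval (tagged x))%:R : rat^o))).

(** The underlying set of [G], pointed at [1]. *)
Definition pointed_group (G : topologicalGroupType) : Type := G.

HB.instance Definition _ (G : topologicalGroupType) :=
  Choice.copy (pointed_group G) G.
HB.instance Definition _ (G : topologicalGroupType) :=
  isPointed.Build (pointed_group G) (1%g : G).

Definition borel (G : topologicalGroupType) :=
  g_sigma_algebraType (@open G : set (set (pointed_group G))).

Section Haar.
Variables (R : realType) (G : topologicalGroupType).
Implicit Type mu : {measure set (borel G) -> \bar R}.

Record left_haar mu : Prop := LeftHaar {
  haar_invariant : forall (g : G) (A : set (borel G)), measurable A ->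
    mu (lcoset g (A : set G)) = mu A ;
  haar_neq0 : mu setT <> 0%E ;
  haar_compact : forall K : set G, compact K -> (mu K < +oo)%E ;
  haar_outer_regular : forall A : set (borel G), measurable A ->
    mu A = ereal_inf [set mu V | V in [set V : set G | open V /\ A `<=` V]] ;
  haar_inner_regular : forall V : set G, open V ->
    mu V = ereal_sup [set mu K | K in [set K : set G | compact K /\ K `<=` V]]
}.

Definition unimodular := forall mu, left_haar mu ->
  forall (g : G) (A : set (borel G)), measurable A ->
    mu (rcoset (A : set G) g) = mu A.

(** [mu] is [mu_U]. *)
Definition normalized_haar (U : CO G) mu := left_haar mu /\ mu U = 1%E.

(** [q . mu] as a real set function.  A multiple of an infinite measure by a
   negative scalar is only a signed measure on the Borel sets of finite measure;
   elsewhere the value is [0], as [fine +oo = 0]. *)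
Definition haar_multiple mu (q : rat) : set G -> R :=
  fun A => ratr q * fine (mu A).

Definition hG_gt0 mu (lambda : set G -> R) :=
  exists2 q : rat, 0 < q & lambda = haar_multiple mu q.

Definition hG_ge0 mu (lambda : set G -> R) := hG_gt0 mu lambda \/ lambda = 0.

(** The trace [Bi(G) -> h_G], for [mu = mu_O]. *)
Definition tr (O : CO G) mu (b : Bi G) : set G -> R :=
  haar_multiple mu (psi O b 1%g).

(** [\sum_i tr (f_i p_i)] for [\sum_i f_i \otimes p_i] the preimage of the identity
   under [xi]; the pairs [(f_i, p_i)] are listed in [s]. *)
Definition HS_rank (O : CO G) mu (P : leftGModType G) : set G -> R :=
  xget 0 [set lambda | exists2 s : seq (Hom P (Bi G) * P),
    xi (\sum_(x <- s) tens x.1 x.2) = id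
    & lambda = \sum_(x <- s) tr O mu (sval x.1 x.2)].

End Haar.

(* Main.v *)
(** A projection f : F -> P from F = (+)_i Q[G/U_i] has an equivariant section
   q, and e = q f is an idempotent of End_G(F).  The rank of P is the multiple
   tau(e) of mu_O, where tau(a) = \sum_j mu_O(U_j)^-1 a(x_j)_{x_j} and x_j is the
   base point of G/U_j: the standard bimodule acts on F by convolution with the
   functions psi(b).  Unimodularity enters through the mass transport principle,
   which makes the matrix of an equivariant endomorphism of F row-finite, gives it
   an adjoint for the standard inner product, and gives tau(ab) = tau(ba).

   Positivity is Kaplansky's argument for idempotents in group algebras.  With e'
   the adjoint of e, t small, v_k = (1 - t e e')^k and f_k = 1 - v_k, the vectors
   e' v_k x tend to 0 while e f_k = f_k.  Since tau(f_k e) = tau(e f_k) = tau(f_k),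
   tau(e) is the limit of \sum_j mu_O(U_j)^-1 |f_k x_j|^2 >= 0; if it vanishes then
   f_k x -> 0 for every base vector x, which forces e = 0. *)

Require Import Defs.
From HB Require Import structures.
From mathcomp Require Import all_boot all_order all_algebra finmap.
From mathcomp Require Import all_classical reals ereal topology measure.
From mathcomp Require Import ring lra.

Set Implicit Arguments.
Unset Strict Implicit.
Unset Printing Implicit Defensive.

Import Order.TTheory GRing.Theory Num.Theory.

Local Open Scope classical_set_scope.
Local Open Scope ring_scope.

(** * Cosets and sums over cosets *)

Section Cosets.
Variable G : groupType.
Implicit Types (g h x y : G) (A B H K U V : set G).

(** The natural route to positivity is the orthogonal projection onto the range of [e], whose trace
    is visibly a sum of squares. That projection need not act on F: it belongs to a completion over
    the reals. Polynomials in [e] and its adjoint do act on F, with rational coefficients, so they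
    replace it, and every limit becomes an estimate with a rational error. The weights in tau are
    forced by the base points having stabilizers of different volumes: only the weighted diagonal
    sum is a trace. Their rational form is [relindex O (U j)]. The rank is defined by choosing one
    decomposition of the identity. It is computed here for an arbitrary one, so independence of the
    choice needs no separate argument. No integral is taken. Every function that occurs is right
    invariant under some compact open subgroup and supported on finitely many of its cosets, so
    integrals are finite coset sums, and Haar measure enters only through volumes of unions of
    cosets. *)

Definition rep A : G := xget 1%g A.

Definition rstable A K := forall x k, A x -> K k -> A (x * k)%g.

Lemma mem_lcoset K g : subgroup K -> lcoset g K g.
Proof. by move=> [K1 _ _]; exists 1%g => //; rewrite mulg1. Qed.

Lemma lcosetP K g x : lcoset g K x <-> K (g^-1 * x)%g.
Proof.
split=> [[k Kk <-]|Kx]; first by rewrite mulKg.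
by exists (g^-1 * x)%g => //; rewrite mulVKg.
Qed.

Lemma lcoset_eqP K g x : subgroup K -> lcoset x K = lcoset g K <-> lcoset g K x.
Proof.
move=> sK; split=> [<-|]; first exact: mem_lcoset.
case: sK => K1 KM KV [k Kk <-]; apply/seteqP; split=> [_ [a Ka <-]|_ [a Ka <-]].
  by exists (k * a)%g; [exact: KM|rewrite mulgA].
exists (k^-1 * a)%g; first by apply: KM => //; exact: KV.
by rewrite -mulgA mulVKg.
Qed.

Lemma rep_lcoset K g : subgroup K -> lcoset g K (rep (lcoset g K)).
Proof. by move=> sK; apply: (xgetPex 1%g); exists g; exact: mem_lcoset. Qed.

Lemma lcoset_rep K g : subgroup K -> lcoset (rep (lcoset g K)) K = lcoset g K.
Proof. by move=> sK; apply/lcoset_eqP => //; exact: rep_lcoset. Qed.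

Lemma rep_lcosetE K g : subgroup K -> exists2 k, K k & rep (lcoset g K) = (g * k)%g.
Proof. by move=> sK; have [k Kk <-] := rep_lcoset g sK; exists k. Qed.

Lemma subgroup_rstable K : subgroup K -> rstable K K.
Proof. by move=> [_ KM _] x k; exact: KM. Qed.

Lemma lcoset_rstable A K g : rstable A K -> rstable (lcoset g A) K.
Proof.
by move=> AK _ k [a Aa <-] Kk; exists (a * k)%g; [exact: AK|rewrite mulgA].
Qed.

Lemma rstableS A K K' : K' `<=` K -> rstable A K -> rstable A K'.
Proof. by move=> KK AK x k Ax /KK; exact: AK. Qed.

Lemma lcoset_subset A K g : rstable A K -> A g -> lcoset g K `<=` A.
Proof. by move=> AK Ag _ [k Kk <-]; exact: AK. Qed.

Lemma subgroup_conjs K g : subgroup K -> subgroup (conjs K g).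
Proof.
move=> [K1 KM KV]; split.
+ by exists 1%g => //; rewrite conj1g.
+ move=> _ _ [x Kx <-] [y Ky <-]; exists (x * y)%g; first exact: KM.
  by rewrite conjMg.
+ by move=> _ [x Kx <-]; exists x^-1%g; [exact: KV|rewrite conjVg].
Qed.

Lemma subgroupI H K : subgroup H -> subgroup K -> subgroup (H `&` K).
Proof.
move=> [H1 HM HV] [K1 KM KV]; split => //.
- by move=> x y [? ?] [? ?]; split; [exact: HM|exact: KM].
- by move=> x [? ?]; split; [exact: HV|exact: KV].
Qed.

Definition lcosets K A : set (set G) := [set lcoset x K | x in A].

Lemma rep_mem K A D : subgroup K -> rstable A K -> lcosets K A D -> A (rep D).
Proof.
by move=> sK AK [x Ax <-]; apply: (lcoset_subset AK Ax); exact: rep_lcoset.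
Qed.

Lemma lcosets_lcoset K A g :
  lcosets K (lcoset g A) = lcoset g @` lcosets K A.
Proof.
apply/seteqP; split=> [_ [_ [a Aa <-] <-]|_ [_ [a Aa <-] <-]].
  by exists (lcoset a K); [exists a|rewrite lcosetM].
by exists (g * a)%g; [exists a|rewrite lcosetM].
Qed.

Lemma rcoset_conjs K x g : rcoset (lcoset x K) g = lcoset (x * g)%g (conjs K g).
Proof.
apply/seteqP; split=> [_ [_ [k Kk <-] <-]|_ [_ [k Kk <-] <-]].
  by exists (k ^ g)%g; [exists k|rewrite -!mulgA -conjgC].
by exists (x * k)%g; [exists k|rewrite -!mulgA -conjgC].
Qed.

Lemma lcosets_rcoset K A g :
  lcosets (conjs K g) (rcoset A g) = (fun D => rcoset D g) @` lcosets K A.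
Proof.
apply/seteqP; split=> [_ [_ [a Aa <-] <-]|_ [_ [a Aa <-] <-]].
  by exists (lcoset a K); [exists a|rewrite rcoset_conjs].
by exists (a * g)%g; [exists a|rewrite rcoset_conjs].
Qed.

Lemma lcoset_inj g : injective (lcoset g : set G -> set G).
Proof.
by move=> A B /(congr1 (lcoset g^-1%g)); rewrite -!lcosetM mulVg !lcoset1.
Qed.

Lemma rcoset_inj g : injective (fun A : set G => rcoset A g).
Proof.
move=> A B /(congr1 (fun C : set G => rcoset C g^-1%g)).
by rewrite /= -!rcosetM mulgV !rcoset1.
Qed.

Lemma trivIset_lcosets K A : subgroup K -> trivIset (lcosets K A) id.
Proof.
move=> sK _ _ [x Ax <-] [y Ay <-] [z [/= zx zy]].
by move/(lcoset_eqP _ _ sK) : zx => <-; move/(lcoset_eqP _ _ sK) : zy => <-.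
Qed.

Lemma bigcup_lcosets K A : subgroup K -> rstable A K ->
  \bigcup_(D in lcosets K A) D = A.
Proof.
move=> sK AK; apply/seteqP; split=> [x [_ [y Ay <-]]|x Ax].
  exact: (lcoset_subset AK Ay).
by exists (lcoset x K); [exists x|exact: mem_lcoset].
Qed.

Lemma lcoset_rep_sub K H x : subgroup K -> subgroup H -> K `<=` H ->
  lcoset (rep (lcoset x K)) H = lcoset x H.
Proof.
move=> sK sH KH; apply/lcoset_eqP => //; have [k Kk ->] := rep_lcosetE x sK.
by exists k => //; exact: KH.
Qed.

Lemma lcosets_rep_sub K H A : subgroup K -> subgroup H -> K `<=` H ->
  [set lcoset (rep E) H | E in lcosets K A] = lcosets H A.
Proof.
move=> sK sH KH; apply/seteqP; split=> [_ [_ [x Ax <-] <-]|_ [x Ax <-]].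
  by rewrite lcoset_rep_sub//; exists x.
by exists (lcoset x K); [exists x|rewrite lcoset_rep_sub].
Qed.

Lemma finite_lcosets_sub K H A : subgroup K -> subgroup H -> K `<=` H ->
  finite_set (lcosets K A) -> finite_set (lcosets H A).
Proof.
by move=> sK sH KH fA; rewrite -(lcosets_rep_sub A sK sH KH); exact: finite_image.
Qed.

End Cosets.

(** * Sums of finitely supported families *)

Section FiniteSums.

Lemma fsbig_partition (V : zmodType) (I J : choiceType) (A : set I) (p : I -> J)
    (F : I -> V) : finite_set A ->
  \sum_(i \in A) F i =
  \sum_(j \in p @` A) \sum_(i \in A `&` p @^-1` [set j]) F i.
Proof.
move=> fA; rewrite !fsbig_finite//; last exact: finite_image.
under [RHS]eq_bigr => j _.
  rewrite fsbig_mkcondr fsbig_finite//.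
  under eq_bigr => i _.
    rewrite (_ : (i \in p @^-1` [set j]) = (p i == j)); last first.
      by apply/idP/idP; rewrite inE /= => /eqP.
    over.
  over.
rewrite exchange_big /=; apply: eq_big_seq => i iA.
have piA : p i \in fset_set (p @` A).
  rewrite in_fset_set ?inE; last exact: finite_image.
  by exists i => //; move: iA; rewrite in_fset_set// inE.
rewrite (big_fsetD1 (p i))//= eqxx big1_fset ?addr0// => j.
by rewrite !inE eq_sym => /andP[/negPf -> _].
Qed.

(** Finite support takes the place of the injectivity asked by [lin_fsum]. A sum with infinite
    support is 0 by convention, while [f] could make the support finite, and the two sides would
    then differ. *)
Lemma fsbig_linear (V W : lmodType rat) (f : V -> W) (I : choiceType)
    (A : set I) (F : I -> V) : linear f ->
  finite_set (A `&` F @^-1` [set~ 0]) ->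
  f (\sum_(i \in A) F i) = \sum_(i \in A) f (F i).
Proof.
move=> fL fA; rewrite fsbig_supp fsbig_finite// (lin_sum fL).
rewrite -fsbig_finite//; apply: fsbig_widen => // i [Ai nFi] /=.
have [->|F0] := eqVneq (F i) 0; first exact: lin0.
by case: nFi; split => //= e; rewrite e eqxx in F0.
Qed.

Lemma fsbig_count (V : lmodType rat) (I : choiceType) (A : set I) (v : V) :
  finite_set A -> \sum_(i \in A) v = (#|` fset_set A|%fset)%:R *: v.
Proof.
move=> fA; rewrite fsbig_finite// big_const_seq count_predT iter_addr_0.
by rewrite scaler_nat.
Qed.

End FiniteSums.

(** * Sums over the left cosets of a subgroup *)

Section CosetSums.
Variables (G : groupType) (W : lmodType rat).
Implicit Types (g h x y : G) (A B H K U V : set G) (F : G -> W).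

(** Up to the volume of [K], the integral over [A] of a right [K]-invariant function. The
    representatives are those of [theta_coset], which therefore unfolds to such a sum. *)
Definition csum K A F : W := \sum_(D \in lcosets K A) F (rep D).

Definition rinv K A F := forall x k, A x -> K k -> F (x * k)%g = F x.

Lemma rinv_rep K A F x : subgroup K -> rinv K A F -> A x ->
  F (rep (lcoset x K)) = F x.
Proof. by move=> sK FK Ax; have [k Kk ->] := rep_lcosetE x sK; exact: FK. Qed.

Lemma eq_csum K A F F' : subgroup K -> rstable A K ->
  (forall x, A x -> F x = F' x) -> csum K A F = csum K A F'.
Proof.
move=> sK AK FF; apply: eq_fsbigr => D; rewrite inE => DA.
by apply: FF; exact: (rep_mem sK AK).
Qed.

Lemma csum_rcoset K A F g : subgroup K -> rinv (conjs K g) (rcoset A g) F ->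
  csum (conjs K g) (rcoset A g) F = csum K A (fun x => F (x * g)%g).
Proof.
move=> sK FK; rewrite /csum lcosets_rcoset fsbig_image; last first.
  by move=> ? ? _ _; exact: rcoset_inj.
apply: eq_fsbigr => _ /set_mem[x Ax <-].
rewrite rcoset_conjs (rinv_rep (subgroup_conjs g sK) FK); last by exists x.
have [k Kk ->] := rep_lcosetE x sK; rewrite -mulgA (conjgC k) mulgA (FK (x * g)%g)//.
  by exists x.
by exists k.
Qed.

Lemma csum_partition K H A F : subgroup K -> subgroup H -> K `<=` H ->
  rstable A H -> finite_set (lcosets K A) ->
  csum K A F = \sum_(D \in lcosets H A) csum K D F.
Proof.
move=> sK sH KH AH fA; rewrite /csum.
rewrite (fsbig_partition (fun E => lcoset (rep E) H))//.
rewrite lcosets_rep_sub//.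
apply: eq_fsbigr => _ /set_mem[x Ax <-]; apply: eq_fsbigl.
apply/seteqP; split=> [_ [[y Ay <-] /=]|_ [y yx <-]].
  by rewrite lcoset_rep_sub// => yx; exists y => //; rewrite -yx; exact: mem_lcoset.
split=> /=; last by rewrite lcoset_rep_sub//; apply/lcoset_eqP.
by exists y => //; exact: (lcoset_subset AH Ax).
Qed.

Lemma lcosets_self K x : subgroup K -> lcosets K (lcoset x K) = [set lcoset x K].
Proof.
move=> sK; apply/seteqP; split=> [_ [y yx <-]|_ ->].
  by apply/lcoset_eqP.
by exists x => //; exact: mem_lcoset.
Qed.

Lemma csum_self K F x : subgroup K -> rinv K (lcoset x K) F ->
  csum K (lcoset x K) F = F x.
Proof.
move=> sK FK; rewrite /csum lcosets_self// fsbig_set1 (rinv_rep sK FK)//.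
exact: mem_lcoset.
Qed.

Lemma csum_const K A (w : W) : finite_set (lcosets K A) ->
  csum K A (fun=> w) = (indexg A K)%:R *: w.
Proof. exact: fsbig_count. Qed.

(** [F] is constant on each coset of [H] in [A], and such a coset splits into |H:K| cosets of
    [K]. *)
Lemma csum_refine K H A F : subgroup K -> subgroup H -> K `<=` H ->
  rstable A H -> finite_set (lcosets K A) -> rinv H A F ->
  csum K A F = (indexg H K)%:R *: csum H A F.
Proof.
move=> sK sH KH AH fA FH.
have fHA := finite_lcosets_sub sK sH KH fA.
rewrite (csum_partition F sK sH KH AH fA) /csum.
rewrite (fsbig_linear (f := fun v => (indexg H K)%:R *: v)); last 2 first.
- by move=> a u v; rewrite scalerDr !scalerA mulrC.
- exact: finite_setIl.
apply: eq_fsbigr => _ /set_mem[x Ax <-].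
have fx : finite_set (lcosets K (lcoset x H)).
  apply: sub_finite_set fA => _ [y yx <-]; exists y => //.
  exact: (lcoset_subset AH Ax).
rewrite (rinv_rep sH FH Ax).
have -> : indexg H K = indexg (lcoset x H) K.
  rewrite /indexg -!/(lcosets _ _) lcosets_lcoset.
  (* Finiteness is known only for cosets inside [A]; it reaches [H] by translating xH back. *)
  have fH : finite_set (lcosets K H).
    have -> : lcosets K H = lcoset x^-1%g @` lcosets K (lcoset x H).
      by rewrite -lcosets_lcoset -lcosetM mulVg lcoset1.
    exact: finite_image.
  by rewrite [in RHS]fset_set_image// card_imfset//; exact: lcoset_inj.
rewrite -csum_const//; apply: eq_csum => //.
  by apply: lcoset_rstable; apply: (rstableS KH); exact: subgroup_rstable.
by move=> _ [k Kk <-]; exact: FH.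
Qed.

End CosetSums.

(** * Haar volumes of compact open subgroups *)

Section OpenSubgroups.
Variable G : topologicalGroupType.
Implicit Types (g h x y : G) (A B H K S : set G) (U V : CO G).

Lemma CO_subgroup U : subgroup U. Proof. by case: (COP U). Qed.
Lemma CO_compact U : compact U. Proof. by case: (COP U). Qed.
Lemma CO_open U : open U. Proof. by case: (COP U). Qed.

Lemma lcosetE g A : lcoset g A = (fun x => (g^-1 * x)%g) @^-1` A.
Proof. by apply/seteqP; split=> x /lcosetP. Qed.

Lemma rcosetE g A : rcoset A g = (fun x => (x * g^-1)%g) @^-1` A.
Proof.
apply/seteqP; split=> [_ [a Aa <-] /=|x /= Ax]; first by rewrite mulgK.
by exists (x * g^-1)%g => //; rewrite mulgVK.
Qed.

Lemma open_lcoset g A : open A -> open (lcoset g A).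
Proof. by move=> oA; rewrite lcosetE; apply: open_comp => // x _; exact: mull_continuous. Qed.

Lemma open_rcoset g A : open A -> open (rcoset A g).
Proof. by move=> oA; rewrite rcosetE; apply: open_comp => // x _; exact: mulr_continuous. Qed.

Lemma open_rstable A K : subgroup K -> open K -> rstable A K -> open A.
Proof.
move=> sK oK AK; rewrite -(bigcup_lcosets sK AK); apply: bigcup_open => _ [x _ <-].
exact: open_lcoset.
Qed.

Lemma closed_subgroup K : subgroup K -> open K -> closed K.
Proof.
move=> sK oK; rewrite -openC; apply: (open_rstable sK oK) => x k nKx Kk Kxk.
case: sK => K1 KM KV; apply: nKx; rewrite -(mulgK k x).
by apply: KM => //; exact: KV.
Qed.

Lemma compact_open_subgroupI U K : subgroup K -> open K ->
  compact_open_subgroup (U `&` K).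
Proof.
move=> sK oK; split.
- by apply: subgroupI => //; exact: CO_subgroup.
- by apply: compact_closedI; [exact: CO_compact|exact: closed_subgroup].
- by apply: openI => //; exact: CO_open.
Qed.

Definition COI U K (sK : subgroup K) (oK : open K) : CO G :=
  MkCO (compact_open_subgroupI U sK oK).

(** Compactness is used in its near-covering form, with the filter of finite sets of cosets ordered
    by inclusion. Near x the coset is constantly xK, hence eventually in the finite set; compactness
    makes this uniform over [A]. *)
Lemma finite_lcosets K A : subgroup K -> open K -> compact A ->
  finite_set (lcosets K A).
Proof.
move=> sK oK cA.
pose up (D : set (set G)) := [set E | finite_set E /\ D `<=` E].
pose F := filter_from (fun D : set (set G) => finite_set D) up.
have FF : Filter F.
  apply: filter_from_filter; first by exists set0; exact: finite_set0.
  move=> D E fD fE; exists (D `|` E); first by rewrite finite_setU.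
  by move=> X [fX]; rewrite subUset => -[? ?]; do !split.
have cov x : A x ->
    \forall x' \near x & D \near F, (D : set (set G)) (lcoset x' K).
  move=> Ax; exists (lcoset x K, up [set lcoset x K]).
    split; last by exists [set lcoset x K] => //; exact: finite_set1.
    by apply: open_nbhs_nbhs; split; [exact: open_lcoset|exact: mem_lcoset].
  move=> [y D] /= [xy [_ xD]]; apply: xD => /=.
  exact/lcoset_eqP.
have [D fD DA] := (compact_near_coveringP A).1 cA _ F _ FF cov.
apply: (sub_finite_set _ fD) => _ [x Ax <-].
have upD : up D D by split.
exact: DA upD _ Ax.
Qed.

Lemma finite_lcosetsCO U A : compact A -> finite_set (lcosets U A).
Proof. by apply: finite_lcosets; [exact: CO_subgroup|exact: CO_open]. Qed.

Lemma compact_lcoset g A : compact A -> compact (lcoset g A).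
Proof.
move=> cA; apply: continuous_compact => //; apply: continuous_subspaceT.
exact: mull_continuous.
Qed.

Lemma compact_invset A : compact A -> compact [set x^-1%g | x in A].
Proof.
move=> cA; apply: continuous_compact => //; apply: continuous_subspaceT.
exact: invg_continuous.
Qed.

Lemma compact_rstable U A : rstable A U -> finite_set (lcosets U A) -> compact A.
Proof.
move=> AU fA; rewrite -(bigcup_lcosets (CO_subgroup U) AU).
rewrite -fsbig_setU// fsbig_finite//; rewrite big_seq; apply: big_ind.
- exact: compact0.
- exact: compactU.
- move=> D; rewrite in_fset_set// inE => -[x _ <-].
  by apply: compact_lcoset; exact: CO_compact.
Qed.

End OpenSubgroups.

(** * Finitely supported invariant functions and their level sets *)

Section Levels.
Variables (G : groupType) (W : lmodType rat).
Implicit Types (K : set G) (F : G -> W).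

Definition nzset F : set G := [set x | F x != 0].

Lemma nzset_rstable K F : rinv K setT F -> rstable (nzset F) K.
Proof. by move=> FK x k; rewrite /nzset /= => Fx Kk; rewrite FK. Qed.

Lemma csum_nzset K F : subgroup K -> rinv K setT F ->
  csum K setT F = csum K (nzset F) F.
Proof.
move=> sK FK; apply/esym/fsbig_widen => [_ [x Fx <-]|_ [[x _ <-] nx] /=].
  by exists x.
rewrite (rinv_rep sK FK)//; apply: contrapT => /eqP Fx; apply: nx.
by exists x.
Qed.

Lemma csum_supp K F T : subgroup K ->
  lcosets K (nzset F) `<=` T -> T `<=` lcosets K setT ->
  csum K setT F = \sum_(D \in T) F (rep D).
Proof.
move=> sK FT TK; apply/esym/fsbig_widen => // D [[x _ <-] nT] /=.
apply: contrapT => /eqP Fx; apply: nT; apply: FT.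
by exists (rep (lcoset x K)) => //; exact: lcoset_rep.
Qed.

Lemma csum_linear K F F' (a : rat) : subgroup K ->
    finite_set (lcosets K (nzset F)) -> finite_set (lcosets K (nzset F')) ->
  csum K setT (fun x => a *: F x + F' x) = a *: csum K setT F + csum K setT F'.
Proof.
move=> sK fF fF'; pose T := lcosets K (nzset F) `|` lcosets K (nzset F').
have fT : finite_set T by rewrite finite_setU.
have TK : T `<=` lcosets K setT by move=> _ [] [x _ <-]; exists x.
rewrite !(@csum_supp K _ T)//; last 3 first.
- by move=> D ?; right.
- by move=> D ?; left.
- move=> _ [x Fx <-]; have [F0|F0] := eqVneq (F x) 0; last by left; exists x.
  by right; exists x => //; move: Fx; rewrite /nzset /= F0 scaler0 add0r.
rewrite (fsbig_linear (f := fun v => a *: v)).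
- by rewrite -fsbig_split.
- by move=> c u v; rewrite scalerDr !scalerA mulrC.
- exact: finite_setIl.
Qed.

Lemma lin_csum (W' : lmodType rat) (f : W -> W') K F : linear f -> subgroup K ->
    finite_set (lcosets K (nzset F)) ->
  f (csum K setT F) = csum K setT (fun x => f (F x)).
Proof.
move=> fL sK fF; rewrite /csum (fsbig_linear fL)//.
apply: sub_finite_set fF => _ [[x _ <-] /= Fx].
exists (rep (lcoset x K)); last exact: lcoset_rep.
by apply/eqP => F0; apply: Fx.
Qed.

(** Grouping the cosets by the value of [F] reduces identities between coset sums to identities
    between indices of level sets. Inversion permutes level sets, and this is how it will act on
    sums. *)
Lemma csum_levels K F : subgroup K -> rinv K setT F ->
    finite_set (lcosets K (nzset F)) ->
  finite_set (F @` nzset F) /\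
  csum K setT F = \sum_(q \in F @` nzset F) (indexg [set x | F x = q] K)%:R *: q.
Proof.
move=> sK FK fF.
have FE : F @` nzset F = (fun D => F (rep D)) @` lcosets K (nzset F).
  apply/seteqP; split=> [_ [x Fx <-]|_ [_ [x Fx <-] <-]].
    by exists (lcoset x K); [exists x|rewrite (rinv_rep sK FK)].
  by exists x => //; rewrite (rinv_rep sK FK).
split; first by rewrite FE; exact: finite_image.
rewrite csum_nzset// /csum (fsbig_partition (fun D => F (rep D)))// -FE.
apply: eq_fsbigr => q /set_mem[y Fy yq].
have -> : lcosets K (nzset F) `&` (fun D => F (rep D)) @^-1` [set q] =
    lcosets K [set x | F x = q].
  apply/seteqP; split=> [_ [[x Fx <-] /=]|_ [x xq <-]].
    by rewrite (rinv_rep sK FK)// => xq; exists x.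
  split; last by rewrite /= (rinv_rep sK FK).
  by exists x => //; rewrite /nzset /= xq -yq.
rewrite -csum_const; last first.
  apply: sub_finite_set fF => _ [x xq <-]; exists x => //.
  by rewrite /nzset /= xq -yq.
apply: eq_fsbigr => _ /set_mem[x xq <-].
by rewrite (rinv_rep sK FK).
Qed.

End Levels.

(** * Volumes, indices and inversion in a unimodular group *)

Section HaarVolume.
Variables (R : realType) (G : topologicalGroupType) (O : CO G).
Variable mu : {measure set (borel G) -> \bar R}.
Hypotheses (uG : unimodular R G) (hmu : normalized_haar O mu).
Implicit Types (g h x y : G) (A B H K S : set G) (U V : CO G).

Let haar : left_haar mu. Proof. by case: hmu. Qed.

Lemma open_measurable A : open A -> measurable (A : set (borel G)).
Proof. by move=> oA; apply: sub_sigma_algebra. Qed.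

Lemma haar_lcoset g A : open A -> mu (lcoset g A) = mu A.
Proof. by move=> /open_measurable; exact: (haar_invariant haar). Qed.

Lemma haar_rcoset g A : open A -> mu (rcoset A g) = mu A.
Proof. by move=> /open_measurable; exact: uG. Qed.

Lemma haar_conjs g A : open A -> mu (conjs A g) = mu A.
Proof.
move=> oA; have -> : conjs A g = lcoset g^-1%g (rcoset A g).
  apply/seteqP; split=> [_ [a Aa <-]|_ [_ [a Aa <-] <-]].
    by exists (a * g)%g; [exists a|].
  by exists a.
by rewrite haar_lcoset ?haar_rcoset//; exact: open_rcoset.
Qed.

Lemma haar_indexg K A : subgroup K -> open K -> rstable A K ->
  finite_set (lcosets K A) -> mu A = ((indexg A K)%:R%:E * mu K)%E.
Proof.
move=> sK oK AK fA; rewrite -{1}(bigcup_lcosets sK AK).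
rewrite (@measure_fin_bigcup _ _ _ mu)//; last 2 first.
- exact: trivIset_lcosets.
- by move=> _ [x _ <-]; apply: open_measurable; exact: open_lcoset.
rewrite (eq_fsbigr (fun=> mu K)); last first.
  by move=> _ /set_mem[x _ <-]; rewrite /= haar_lcoset.
rewrite fsbig_finite// big_const_seq count_predT iter_addr_0.
by rewrite mule_natl.
Qed.

Definition invset A : set G := [set x^-1%g | x in A].

Lemma invsetE A : invset A = (fun x => x^-1%g) @^-1` A.
Proof.
apply/seteqP; split=> [_ [a Aa <-] /=|x /= Ax]; first by rewrite invgK.
by exists x^-1%g => //; rewrite invgK.
Qed.

Lemma invset_lcoset x V : invset (lcoset x V) = rcoset V x^-1%g.
Proof.
have [_ _ VV] := CO_subgroup V.
apply/seteqP; split=> [_ [_ [v Vv <-] <-]|_ [v Vv <-]].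
  by exists v^-1%g; [exact: VV|rewrite invgM].
exists (x * v^-1)%g; last by rewrite invgM invgK.
by exists v^-1%g => //; exact: VV.
Qed.

(** Inversion turns the left coset xV into the right translate of [V] by the inverse of x, and
    unimodularity gives the latter the measure of [V]. *)
Lemma haar_indexg_inv V A : rstable A V -> finite_set (lcosets V A) ->
  mu (invset A) = ((indexg A V)%:R%:E * mu V)%E.
Proof.
move=> AV fA.
have sV := CO_subgroup V.
have -> : invset A = \bigcup_(D in lcosets V A) invset D.
  rewrite -{1}(bigcup_lcosets sV AV); apply/seteqP; split.
    by move=> _ [x [D AD Dx] <-]; exists D => //; exists x.
  by move=> _ [D AD [x Dx <-]]; exists x => //; exists D.
rewrite (@measure_fin_bigcup _ _ _ mu)//; last 2 first.
- move=> D E AD AE [_ [[x Dx <-] [y Ey] /invg_inj yx]].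
  by apply: (trivIset_lcosets sV AD AE); exists x; split => //=; rewrite -yx.
- move=> _ [x _ <-]; apply: open_measurable; rewrite invset_lcoset.
  by apply: open_rcoset; exact: CO_open.
rewrite (eq_fsbigr (fun=> mu V)); last first.
  move=> _ /set_mem[x _ <-] /=; rewrite invset_lcoset haar_rcoset//.
  exact: CO_open.
by rewrite fsbig_finite// big_const_seq count_predT iter_addr_0 mule_natl.
Qed.

Definition vol A : R := fine (mu A).

Lemma fin_num_haar A : compact A -> mu A \is a fin_num.
Proof.
move=> cA; rewrite ge0_fin_numE; first exact: (haar_compact haar).
exact: measure_ge0.
Qed.

Lemma vol_indexg U A : rstable A U -> finite_set (lcosets U A) ->
  vol A = (indexg A U)%:R * vol U.
Proof.
move=> AU fA; rewrite /vol (@haar_indexg U A)// ?fineM//.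
- by apply: fin_num_haar; exact: CO_compact.
- exact: CO_subgroup.
- exact: CO_open.
Qed.

Lemma vol_indexg_inv V A : rstable A V -> finite_set (lcosets V A) ->
  vol (invset A) = (indexg A V)%:R * vol V.
Proof.
move=> AU fA; rewrite /vol (@haar_indexg_inv V A)// ?fineM//.
by apply: fin_num_haar; exact: CO_compact.
Qed.

Lemma vol_sub U V : V `<=` U -> vol U = (indexg U V)%:R * vol V.
Proof.
move=> VU; apply: vol_indexg; last by apply: finite_lcosetsCO; exact: CO_compact.
by apply: (rstableS VU); apply: subgroup_rstable; exact: CO_subgroup.
Qed.

Let OI U := COI O (CO_subgroup U) (CO_open U).
Let UI U := COI U (CO_subgroup O) (CO_open O).

Lemma indexg_gt0 U V : (0 < indexg U V)%N.
Proof.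
have fU : finite_set (lcosets V U) by apply: finite_lcosetsCO; exact: CO_compact.
rewrite /indexg cardfs_gt0; apply/fset0Pn; exists (lcoset 1%g V).
rewrite in_fset_set// inE; exists 1%g => //.
by case: (CO_subgroup U).
Qed.

(** Finitely many translates of the intersection of [O] and [U] cover [O], which has volume 1, so
    this intersection is not null. *)
Lemma vol_gt0 U : 0 < vol U.
Proof.
have OU : O `&` U `<=` O by move=> ? [].
have UO : O `&` U `<=` U by move=> ? [].
have vO : vol O = 1 by rewrite /vol; case: hmu => _ ->.
have := @vol_sub O (OI U) OU; rewrite vO => /esym e.
have OU0 : 0 < vol (OI U).
  rewrite lt_neqAle; apply/andP; split; last by rewrite fine_ge0.
  apply/eqP => v0; move: e; rewrite -v0 mulr0 => /eqP.
  by rewrite eq_sym oner_eq0.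
by rewrite (@vol_sub U (OI U) UO) mulr_gt0// ltr0n indexg_gt0.
Qed.

(** Both [O] and [U] are measured by their common open subgroup. The rational [relindex O U] is thus
    the inverse of a real volume, which lets later arguments stay over the rationals. *)
Lemma relindex_vol U : ratr (relindex O U) * vol U = 1.
Proof.
have OU : O `&` U `<=` O by move=> ? [].
have UO : U `&` O `<=` U by move=> ? [].
have vO : vol O = 1 by rewrite /vol; case: hmu => _ ->.
have e : CO_set (OI U) = UI U by rewrite /= setIC.
have := @vol_sub O (OI U) OU; rewrite vO /= => e1.
have := @vol_sub U (UI U) UO; rewrite -e /= => e2.
rewrite /relindex rmorphM/= fmorphV/= !ratr_nat e2.
rewrite mulrA mulfVK -?e1//.
by rewrite pnatr_eq0 -lt0n; exact: (indexg_gt0 U (OI U)).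
Qed.

Lemma relindexE U : ratr (relindex O U) = (vol U)^-1.
Proof.
by apply/(mulIf (lt0r_neq0 (vol_gt0 U))); rewrite relindex_vol mulVf// lt0r_neq0// vol_gt0.
Qed.

Lemma relindex_gt0 U : 0 < relindex O U.
Proof. by rewrite -(ltr0q R) relindexE invr_gt0 vol_gt0. Qed.

Lemma relindex_sub U V : V `<=` U ->
  relindex O V = relindex O U * (indexg U V)%:R.
Proof.
move=> VU; apply: (fmorph_inj (@ratr R)); rewrite [in RHS]rmorphM/= ratr_nat !relindexE.
rewrite (vol_sub VU) invfM mulrAC mulVf ?mul1r//.
by rewrite pnatr_eq0 -lt0n indexg_gt0.
Qed.

Lemma relindex_conjCO U g : relindex O (conjs U g) = relindex O U.
Proof.
apply: (fmorph_inj (@ratr R)) => /=.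
by rewrite (relindexE (conjCO U g)) relindexE /vol haar_conjs//; exact: CO_open.
Qed.

(** Both indices measure [A]: it is a union of left translates of [U], and, as the inverse of
    [invset A], also a union of right translates of [V]. *)
Lemma indexg_inv U V A : rstable A U -> finite_set (lcosets U A) ->
    rstable (invset A) V ->
  finite_set (lcosets V (invset A)) /\
  relindex O V * (indexg A U)%:R = relindex O U * (indexg (invset A) V)%:R.
Proof.
move=> AU fA AV.
have fV : finite_set (lcosets V (invset A)).
  by apply: finite_lcosetsCO; apply: compact_invset; exact: (compact_rstable AU).
split => //; apply: (fmorph_inj (@ratr R)).
rewrite [in LHS]rmorphM [in RHS]rmorphM/= !ratr_nat !relindexE.
have vU := lt0r_neq0 (vol_gt0 U); have vV := lt0r_neq0 (vol_gt0 V).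
have vA : invset (invset A) = A.
  apply/seteqP; split=> [_ [_ [x Ax <-] <-]|x Ax]; first by rewrite invgK.
  by exists x^-1%g; [exists x|rewrite invgK].
have -> : (indexg A U)%:R = vol A / vol U by rewrite (vol_indexg AU fA) mulfK.
have -> : (indexg (invset A) V)%:R = vol A / vol V.
  by rewrite -{2}vA (vol_indexg_inv AV fV) mulfK.
by rewrite mulrC mulrAC mulrC mulrA.
Qed.

(* For [F] the indicator of [S], both sides are [relindex O U * relindex O V] times
   the volume of [S]. *)
Lemma csum_inv (W : lmodType rat) U V (F : G -> W) : rinv U setT F ->
    rinv V setT (fun x => F x^-1%g) -> finite_set (lcosets U (nzset F)) ->
  finite_set (lcosets V (nzset (fun x => F x^-1%g))) /\
  relindex O V *: csum U setT F = relindex O U *: csum V setT (fun x => F x^-1%g).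
Proof.
move=> FU FV fF; set F' := fun x => _.
have sU := CO_subgroup U; have sV := CO_subgroup V.
have nz : nzset F' = invset (nzset F) by rewrite invsetE.
have fF' : finite_set (lcosets V (nzset F')).
  rewrite nz; apply: (@indexg_inv U V _ (nzset_rstable FU) fF _).1.
  by rewrite -nz; exact: (nzset_rstable FV).
split => //.
have [fl ->] := csum_levels sU FU fF; have [_ ->] := csum_levels sV FV fF'.
have -> : F' @` nzset F' = F @` nzset F.
  apply/seteqP; split=> [_ [x Fx <-]|_ [x Fx <-]]; exists x^-1%g => //.
    by rewrite /F' /nzset /= invgK.
  by rewrite /F' invgK.
rewrite !(fsbig_linear (f := fun v => _ *: v)); last 4 first.
- by move=> a u v; rewrite scalerDr !scalerA mulrC.
- exact: finite_setIl.
- by move=> a u v; rewrite scalerDr !scalerA mulrC.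
- exact: finite_setIl.
apply: eq_fsbigr => q /set_mem[y Fy yq]; rewrite !scalerA; congr (_ *: _).
have -> : [set x | F' x = q] = invset [set x | F x = q] by rewrite invsetE.
apply: (@indexg_inv U V [set x | F x = q] _ _ _).2.
- by move=> x u /= <- Uu; rewrite FU.
- apply: sub_finite_set fF => _ [x xq <-]; exists x => //.
  by rewrite /nzset /= xq -yq.
- by rewrite invsetE => x v /= <- Vv; rewrite FV.
Qed.

End HaarVolume.

(** * Multiplicativity of indices, and cosets as a type *)

Section CosetIndex.
Variable G : groupType.
Implicit Types (g h x y : G) (A H K U V : set G).

Lemma indexgM K H A : subgroup K -> subgroup H -> K `<=` H ->
  rstable A H -> finite_set (lcosets K A) ->
  indexg A K = (indexg A H * indexg H K)%N.
Proof.
move=> sK sH KH AH fA.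
have fHA := finite_lcosets_sub sK sH KH fA.
(* Cosets are counted by summing the constant 1. *)
have := csum_refine (F := fun=> 1 : rat^o) sK sH KH AH fA (fun _ _ _ _ => erefl).
rewrite !csum_const// => e; apply/eqP.
rewrite -(eqr_nat rat) natrM mulrC; apply/eqP.
by have := e; rewrite /GRing.scale /= !mulr1.
Qed.

Lemma cosetsP U (C : cosets U) : exists g, sval C = lcoset g U.
Proof. by case: C => C /= /asboolP. Qed.

Lemma lcoset_cosetsP g U : cosets_pred U (lcoset g U).
Proof. by apply/asboolP; exists g. Qed.

Definition mkcoset U g : cosets U := exist (fun C => cosets_pred U C) _ (lcoset_cosetsP g U).

Lemma cosets_bij V A : subgroup V -> rstable A V ->
  set_bij [set D : cosets V | sval D `<=` A] (lcosets V A) (fun D => sval D).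
Proof.
move=> sV AV; split=> [D /= DA|D E _ _|_ [x Ax <-]].
- have [g Dg] := cosetsP D; exists g => //; apply: DA; rewrite Dg.
  exact: mem_lcoset.
- exact: cosets_eq.
- by exists (mkcoset V x) => //=; exact: lcoset_subset.
Qed.

(** [transition] sums over the type [cosets V], while [csum] sums over a set of sets; this passes
    from one to the other. *)
Lemma fsum_cosets (W : zmodType) V A (F : set G -> W) : subgroup V -> rstable A V ->
  \sum_(D \in [set D : cosets V | sval D `<=` A]) F (sval D) =
  \sum_(D \in lcosets V A) F D.
Proof. by move=> sV AV; apply/esym; exact: (reindex_fsbig _ _ _ _ (cosets_bij sV AV)). Qed.

Lemma finite_cosets V A : subgroup V -> rstable A V -> finite_set (lcosets V A) ->
  finite_set [set D : cosets V | sval D `<=` A].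
Proof.
move=> sV AV fA; rewrite (_ : [set _ | _] = (fun D : cosets V => sval D) @^-1` (lcosets V A)).
  by apply: finite_preimage => // ? ? _ _; exact: cosets_eq.
apply/seteqP; split=> [D DA|D /= [x Ax <-]].
  by have [h _ _] := cosets_bij sV AV; exact: h.
exact: lcoset_subset.
Qed.

End CosetIndex.

Section FreeInduction.
Variable X : choiceType.

Lemma lext_id (u : freeQ X) : lext (@delta X) u = u.
Proof.
apply: (freeQ_ind_lin (lext_linear _) (g := id)) => // x.
exact: lext_delta.
Qed.

Lemma freeQ_ind (Q : freeQ X -> Prop) : Q 0 ->
  (forall a u v, Q u -> Q v -> Q (a *: u + v)) ->
  (forall x, Q (delta x)) -> forall u, Q u.
Proof.
move=> Q0 QL Qd u; rewrite -[u]lext_id (lextE _ (fsubset_refl _)).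
elim: (enum_fset _) => [|x s IH]; first by rewrite big_nil.
by rewrite big_cons; exact: QL.
Qed.

End FreeInduction.

(** * The maps theta, xi and psi *)

Section BiFacts.
Variable G : topologicalGroupType.
Implicit Types (U V : CO G) (b : Bi G).

Definition bicoset U (C : cosets U) : Bi G := lpi (@bi_rel G) (bcoset C).

Lemma bi_ind (Q : Bi G -> Prop) : Q 0 ->
  (forall a u v, Q u -> Q v -> Q (a *: u + v)) ->
  (forall U (C : cosets U), Q (bicoset C)) -> forall b, Q b.
Proof.
move=> Q0 QL Qd b; rewrite -[b]lreprK.
elim/freeQ_ind: (lrepr b : freeQ _) => [|a u v Qu Qv|[U C]]; last exact: Qd.
  by rewrite (lin0 (@lpi_linear _ (@bi_rel G))).
by rewrite lpi_linear; exact: QL.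
Qed.

Lemma bi_eq_lin (W : lmodType rat) (f g : Bi G -> W) : linear f -> linear g ->
  (forall U (C : cosets U), f (bicoset C) = g (bicoset C)) -> f =1 g.
Proof.
move=> fL gL fg; apply: bi_ind => // [|a u v fu fv].
  by rewrite (lin0 fL) (lin0 gL).
by rewrite fL gL fu fv.
Qed.

Lemma relindex_nested U V : V `<=` U -> relindex U V = (indexg U V)%:R.
Proof.
move=> VU; rewrite /relindex (_ : (U : set G) `&` V = V); last exact: setIidr.
rewrite /indexg -/(lcosets V V) -[X in lcosets V X]lcoset1.
by rewrite lcosets_self ?fset_set1 ?cardfs1 ?divr1//; exact: CO_subgroup.
Qed.

(** * The universal property of the direct limit: families compatible with the transition maps *)

Section Lift.
Variables (W : lmodType rat) (F : forall U, cosets U -> W).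
Hypothesis F_rel : forall U V (C : cosets U), V `<=` U ->
  F C = (relindex U V)^-1 *: \sum_(D \in [set D : cosets V | sval D `<=` sval C]) F D.

Let lF := lext (fun x : cosets_sum (fun U : CO G => U : set G) => F (tagged x)).

Lemma coset_rstable U V (C : cosets U) : V `<=` U -> rstable (sval C) V.
Proof.
move=> VU; have [g ->] := cosetsP C; apply: lcoset_rstable.
by apply: (rstableS VU); apply: subgroup_rstable; exact: CO_subgroup.
Qed.

Lemma finite_coset (U : CO G) (K : set G) (C : cosets U) : subgroup K -> open K ->
  finite_set (lcosets K (sval C)).
Proof.
move=> sK oK; have [g ->] := cosetsP C; apply: finite_lcosets => //.
by apply: compact_lcoset; exact: CO_compact.
Qed.

Lemma lext_bi_rel r : bi_rel r -> lF r = 0.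
Proof.
move=> [U [V [C [VU ->]]]].
have lFL : linear lF by exact: lext_linear.
have lFd U' (D : cosets U') : lF (bcoset D) = F D by rewrite /lF /bcoset lext_delta.
rewrite (linB lFL) lFd /transition (linZ lFL) (fsbig_linear lFL).
  under eq_fsbigr do rewrite lFd.
  by rewrite -F_rel// subrr.
apply: finite_setIl; apply: finite_cosets.
- exact: CO_subgroup.
- exact: coset_rstable.
- by apply: finite_coset; [exact: CO_subgroup|exact: CO_open].
Qed.

Lemma bi_lift_linear : linear (qlift lF : Bi G -> W).
Proof. by apply: qlift_linear; [exact: lext_linear|exact: lext_bi_rel]. Qed.

Lemma bi_lift_bicoset U (C : cosets U) : (qlift lF : Bi G -> W) (bicoset C) = F C.
Proof.
rewrite /bicoset qliftE; last exact: lext_bi_rel; last exact: lext_linear.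
by rewrite /lF /bcoset lext_delta.
Qed.

End Lift.
End BiFacts.

(** * The maps [theta] and [xi] on generators *)

Section ThetaFacts.
Variables (G : topologicalGroupType) (M : leftGModType G).
Hypothesis dM : discrete M.
Implicit Types (U V : CO G) (b : Bi G) (m : M).

Let lactL g := @lact_linear G M g.

Lemma stabilizer_subgroup m : subgroup (stabilizer m).
Proof.
split => [|x y|x]; rewrite /stabilizer /=.
- exact: lact1.
- by move=> xm ym; rewrite lactM ym.
- by move=> {1}<-; rewrite -lactM mulVg lact1.
Qed.

Definition COstab U m : CO G := COI U (stabilizer_subgroup m) (dM m).

Lemma lact_rinv (A K : set G) m : K `<=` stabilizer m ->
  rinv K A (fun x => lact x m).
Proof. by move=> Km x k _ /Km; rewrite lactM => ->. Qed.

(** Refining the cosets multiplies the sum and the index by the same factor. Averages attached to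
    different vectors can thus be taken over one common subgroup. *)
Lemma theta_cosetE U V (C : cosets U) m : V `<=` U -> V `<=` stabilizer m ->
  theta_coset C m = (indexg U V)%:R^-1 *: csum V (sval C) (fun x => lact x m).
Proof.
move=> VU Vm; pose W := COstab U m.
have sV := CO_subgroup V; have sW := CO_subgroup W; have sU := CO_subgroup U.
have VW : V `<=` W by move=> v Vv; split; [exact: VU|exact: Vm].
have WU : W `<=` U by move=> v [].
have fV : finite_set (lcosets V (sval C)).
  by apply: finite_coset; [exact: CO_subgroup|exact: CO_open].
rewrite (csum_refine sV sW VW (coset_rstable WU) fV); last first.
  by apply: lact_rinv => v [].
have -> : indexg U V = (indexg U W * indexg W V)%N.
  apply: indexgM => //; first by apply: (rstableS WU); exact: subgroup_rstable.
  by apply: finite_lcosetsCO; exact: CO_compact.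
rewrite scalerA natrM invfM mulfVK//.
by rewrite pnatr_eq0 -lt0n indexg_gt0.
Qed.

Lemma theta_coset_rel U V (C : cosets U) m : V `<=` U ->
  theta_coset C m = (relindex U V)^-1 *:
    \sum_(D \in [set D : cosets V | sval D `<=` sval C]) theta_coset D m.
Proof.
move=> VU; pose K := COstab V m.
have sV := CO_subgroup V; have sK := CO_subgroup K; have sU := CO_subgroup U.
have KV : K `<=` V by move=> v [].
have Km : K `<=` stabilizer m by move=> v [].
have KU : K `<=` U by move=> v /KV/VU.
have fK : finite_set (lcosets K (sval C)).
  by apply: finite_coset; [exact: CO_subgroup|exact: CO_open].
have VC := coset_rstable VU (C := C).
rewrite (theta_cosetE C KU Km).
under eq_fsbigr do rewrite (theta_cosetE _ KV Km).
rewrite (fsum_cosets (fun D => _ *: csum K D (fun x => lact x m)) sV VC).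
rewrite -(fsbig_linear (f := fun v => (indexg V K)%:R^-1 *: v)); last 2 first.
- by move=> a u v; rewrite scalerDr !scalerA mulrC.
- apply: finite_setIl; exact: (finite_lcosets_sub sK sV KV).
rewrite -csum_partition// scalerA; congr (_ *: _).
rewrite (relindex_nested VU).
rewrite -invfM -natrM; congr (_%:R^-1).
apply: indexgM => //; last by apply: finite_lcosetsCO; exact: CO_compact.
by apply: (rstableS VU); exact: subgroup_rstable.
Qed.

Lemma theta_bi_linear m : linear (fun b => theta_bi b m).
Proof.
apply: (bi_lift_linear (F := fun U (C : cosets U) => theta_coset C m)).
by move=> ? ? ?; exact: theta_coset_rel.
Qed.

Lemma theta_bi_bicoset U (C : cosets U) m :
  theta_bi (bicoset C) m = theta_coset C m.
Proof.
apply: (bi_lift_bicoset (F := fun U (C : cosets U) => theta_coset C m)).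
by move=> ? ? ?; exact: theta_coset_rel.
Qed.

Lemma theta_bi_linearr b : linear (theta_bi b : M -> M).
Proof.
move=> a m m'; move: b; apply: bi_eq_lin.
- exact: theta_bi_linear.
- move=> c u v; rewrite !theta_bi_linear !scalerDr !scalerA mulrC addrACA.
  by rewrite -!scalerA.
move=> U C; rewrite !theta_bi_bicoset.
(* A subgroup fixing [m] and [m'] also fixes their combination, so the three averages run over the
   same cosets. *)
pose K := COstab (COstab U m) m'.
have KU : K `<=` U by move=> v [[]].
have Km : K `<=` stabilizer m by move=> v [[]].
have Km' : K `<=` stabilizer m' by move=> v [].
have fK : finite_set (lcosets K (sval C)).
  by apply: finite_coset; [exact: CO_subgroup|exact: CO_open].
have Kmm : K `<=` stabilizer (a *: m + m').
  by move=> x Kx; rewrite /stabilizer /= lactL (Km _ Kx) (Km' _ Kx).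
rewrite !(theta_cosetE C KU)// scalerA mulrC -scalerA -scalerDr; congr (_ *: _).
rewrite /csum (fsbig_linear (f := fun v => a *: v)); last 2 first.
- by move=> c u v; rewrite scalerDr !scalerA mulrC.
- exact: finite_setIl.
rewrite -fsbig_split//; apply: eq_fsbigr => D _.
exact: lactL.
Qed.

(** If [K] fixes gm then its conjugate by [g] fixes [m], and right translation by [g] matches the
    cosets of the two subgroups. *)
Lemma theta_bi_ract b g m : theta_bi (ract b g) m = theta_bi b (lact g m).
Proof.
move: b; apply: bi_eq_lin.
- by move=> a u v; rewrite ract_linear theta_bi_linear.
- exact: theta_bi_linear.
move=> U C; rewrite theta_bi_bicoset.
have -> : ract (bicoset C) g = bicoset (cosets_rmul C g : cosets (conjCO U g)).
  by rewrite /bicoset -[RHS](congr1 _ (ract_bcoset g C)); exact: bi_ractE.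
rewrite theta_bi_bicoset.
pose K := COstab U (lact g m); pose Kg := conjCO K g.
have KU : K `<=` U by move=> v [].
have Km : K `<=` stabilizer (lact g m) by move=> v [].
have KgU : Kg `<=` conjCO U g by move=> _ [v /KU Uv <-]; exists v.
have Kgm : Kg `<=` stabilizer m.
  move=> _ [v /Km vm <-]; rewrite /stabilizer /= conjgE !lactM vm.
  by rewrite -lactM mulVg lact1.
rewrite (theta_cosetE _ KgU Kgm) (theta_cosetE _ KU Km).
rewrite indexg_conjs; congr (_ *: _).
rewrite csum_rcoset; last 2 first.
- exact: CO_subgroup.
- exact: lact_rinv.
by apply: eq_fsbigr => D _; rewrite lactM.
Qed.

Lemma tensor_lift_linear (N : rightGModType G) (W : lmodType rat) (F : N -> M -> W) :
  (forall m, linear (F ^~ m)) -> (forall n, linear (F n)) ->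
  (forall n g m, F (ract n g) m = F n (lact g m)) ->
  linear (qlift (lext (fun x => F x.1 x.2)) : tensor N M -> W) /\
  forall n m, (qlift (lext (fun x => F x.1 x.2)) : tensor N M -> W) (tens n m) = F n m.
Proof.
move=> Fl Fr FG; set l := lext _.
have lL : linear l by exact: lext_linear.
have ld n m : l (delta (n, m)) = F n m by rewrite /l lext_delta.
have lR r : tensor_rel r -> l r = 0.
  move=> [[a [n [n' [m ->]]]]|[a [n [m [m' ->]]]]|[n [g [m ->]]]];
    rewrite (linB lL) ?lL !ld.
  - by rewrite (Fl m) subrr.
  - by rewrite (Fr n) subrr.
  - by rewrite FG subrr.
split; first exact: qlift_linear.
by move=> n m; rewrite /tens qliftE.
Qed.

Lemma theta_tens b m : theta (tens b m) = theta_bi b m.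
Proof.
apply: (tensor_lift_linear (F := @theta_bi G M) _ _ _).2.
- exact: theta_bi_linear.
- exact: theta_bi_linearr.
- exact: theta_bi_ract.
Qed.

(** Written with [theta] of a tensor and not with [theta_bi], so that [xi] is by conversion the lift
    of this map. *)
Definition xi_pair (f : Defs.Hom M (Bi G)) (p : M) : M -> M :=
  fun p' => theta (tens (sval f p') p).

Lemma xi_pairE f p p' : xi_pair f p p' = theta_bi (sval f p') p.
Proof. exact: theta_tens. Qed.

Lemma xi_lift : linear (qlift (lext (fun x => xi_pair x.1 x.2)) :
    tensor (Defs.Hom M (Bi G)) M -> (M -> M)) /\
  forall f m, (qlift (lext (fun x => xi_pair x.1 x.2)) :
    tensor (Defs.Hom M (Bi G)) M -> (M -> M)) (tens f m) = xi_pair f m.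
Proof.
apply: tensor_lift_linear => [m a u v|n a u v|n g m]; apply/funext => p';
  rewrite xi_pairE.
- by rewrite [LHS]theta_bi_linear -!xi_pairE.
- by rewrite [LHS]theta_bi_linearr -!xi_pairE.
- by rewrite xi_pairE [LHS]theta_bi_ract.
Qed.

Lemma xi_linear : linear (@xi G M).
Proof. exact (proj1 xi_lift). Qed.

Lemma xi_tens (f : Defs.Hom M (Bi G)) (p p' : M) :
  xi (tens f p) p' = theta_bi (sval f p') p.
Proof.
rewrite -xi_pairE; exact (congr1 (fun h : M -> M => h p') (proj2 xi_lift f p)).
Qed.

End ThetaFacts.

(** * The functions [psi O b], and [theta] expressed through them *)

Section PsiFacts.
Variables (R : realType) (G : topologicalGroupType) (O : CO G).
Variable mu : {measure set (borel G) -> \bar R}.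
Hypothesis hmu : normalized_haar O mu.
Implicit Types (U V : CO G) (b : Bi G).

Let Fpsi U (C : cosets U) : G -> rat^o :=
  relindex O U *: (fun g : G => (g \in sval C)%:R : rat^o).

(** The indicator of a coset of [U] is the sum of the indicators of the cosets of [V] inside it, and
    the factor |U:V| of the transition map is the ratio of the two weights. *)
Lemma psi_rel U V (C : cosets U) : V `<=` U ->
  Fpsi C = (relindex U V)^-1 *: \sum_(D \in [set D : cosets V | sval D `<=` sval C]) Fpsi D.
Proof.
move=> VU; have VC := coset_rstable VU (C := C); have sV := CO_subgroup V.
have fV : finite_set (lcosets V (sval C)).
  by apply: finite_coset => //; exact: CO_open.
apply/funext => x; pose ev (f : G -> rat^o) := f x.
rewrite -[RHS]/(ev _) (linZ (f := ev))// (fsbig_linear (f := ev))//; last first.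
  by apply: finite_setIl; exact: finite_cosets.
rewrite (fsum_cosets (fun D => relindex O V *: ((x \in D)%:R : rat^o)))//.
rewrite /Fpsi (relindex_nested VU) (relindex_sub hmu VU).
rewrite -[LHS]/(_ *: ((x \in sval C)%:R : rat^o)).
have -> : \sum_(D \in lcosets V (sval C)) relindex O U * (indexg U V)%:R *: ((x \in D)%:R : rat^o)
  = (relindex O U * (indexg U V)%:R) *: ((x \in sval C)%:R : rat^o).
  have [xC|xC] := pselect (sval C x); last first.
    rewrite memNset// scaler0; apply: fsbig1 => _ [y yC <-].
    rewrite memNset ?scaler0// => yx; apply: xC; exact: (lcoset_subset VC yC).
  rewrite -(@fsbig_widen _ _ _ _ [set lcoset x V])//.
  - by rewrite fsbig_set1 !mem_set//; exact: mem_lcoset.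
  - by move=> _ ->; exists x.
  move=> _ [[y yC <-] /= nx]; rewrite memNset ?scaler0// => yx; apply: nx.
  by apply/esym/lcoset_eqP.
rewrite scalerA mulrCA mulVf ?mulr1//.
by rewrite pnatr_eq0 -lt0n indexg_gt0.
Qed.

Lemma psi_linear : linear (@psi G O).
Proof. by apply: (bi_lift_linear (F := Fpsi)); exact: psi_rel. Qed.

Lemma psi_bicoset U (C : cosets U) x :
  psi O (bicoset C) x = relindex O U * (x \in sval C)%:R.
Proof. by rewrite /psi (bi_lift_bicoset (F := Fpsi) psi_rel). Qed.

Lemma psi_lact g b x : psi O (lact g b) x = psi O b (g^-1 * x)%g.
Proof.
move: b; pose ev y (f : G -> rat^o) := f y.
apply: (bi_eq_lin (f := fun b => ev x (psi O (lact g b)))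
  (g := fun b => ev (g^-1 * x)%g (psi O b))) => [a u v|a u v|U C].
- by rewrite lact_linear psi_linear.
- by rewrite psi_linear.
have -> : lact g (bicoset C) = bicoset (cosets_lmul g C).
  by rewrite /bicoset -lact_bcoset; exact: bi_lactE.
rewrite /ev !psi_bicoset; congr (_ * (nat_of_bool _)%:R).
by apply/idP/idP => /set_mem => [/lcosetP|] gx; apply/mem_set => //; apply/lcosetP.
Qed.

Variable M : leftGModType G.
Hypothesis dM : discrete M.

(* [theta_bi b m] is the integral of [psi O b x *: x m] over [x] in [G]. *)
Lemma theta_psi b (m : M) : exists V0 : CO G, forall V, V `<=` V0 ->
  [/\ V `<=` stabilizer m, rinv V setT (psi O b),
     finite_set (lcosets V (nzset (psi O b)))
   & theta_bi b m = (relindex O V)^-1 *: csum V setT (fun x => psi O b x *: lact x m)].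
Proof.
move: b; apply: bi_ind => [|a u v [V1 h1] [V2 h2]|U C].
- exists (COstab dM O m) => V VO.
  have p0 : psi O (0 : Bi G) = 0 by exact: (lin0 psi_linear).
  have n0 : lcosets V (nzset (psi O (0 : Bi G))) = set0.
    apply/seteqP; split=> // D [x px _]; by move: px; rewrite p0 /nzset /= => /eqP; case.
  split; first by move=> x /VO[].
  + by move=> x k _ _; rewrite p0.
  + by rewrite n0; exact: finite_set0.
  rewrite (lin0 (theta_bi_linear dM m)) p0 /csum fsbig1 ?scaler0// => D _.
  by rewrite scale0r.
(* The claim holds for every [V] below a threshold, so two thresholds can be intersected; this is
   what makes the induction over linear combinations work. *)
- exists (COI V1 (CO_subgroup V2) (CO_open V2)) => V VV.
  have [|Vm r1 f1 e1] := h1 V; first by move=> x /VV[].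
  have [|_ r2 f2 e2] := h2 V; first by move=> x /VV[].
  have pE x : psi O (a *: u + v) x = a * psi O u x + psi O v x.
    by rewrite psi_linear.
  split=> //.
  + by move=> x k _ Vk; rewrite !pE r1// r2.
  + apply: (@sub_finite_set _ _ (lcosets V (nzset (psi O u)) `|` lcosets V (nzset (psi O v)))).
      move=> _ [x px <-]; have [u0|u0] := eqVneq (psi O u x) 0; last by left; exists x.
      by right; exists x => //; move: px; rewrite /nzset /= pE u0 mulr0 add0r.
    by rewrite finite_setU.
  have fS w : finite_set (lcosets V (nzset (psi O w))) ->
      finite_set (lcosets V (nzset (fun x => psi O w x *: lact x m))).
    apply: sub_finite_set => _ [x px <-]; exists x => //.
    by apply: contraNN px => /eqP ->; rewrite scale0r.
  rewrite (theta_bi_linear dM m) e1 e2 scalerA mulrC -scalerA -scalerDr.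
  rewrite -csum_linear; [|exact: CO_subgroup|exact: fS|exact: fS].
  congr (_ *: _); apply: eq_fsbigr => D _.
  by rewrite pE scalerA -scalerDl.
- exists (COstab dM U m) => V VW.
  have VU : V `<=` U by move=> x /VW[].
  have Vm : V `<=` stabilizer m by move=> x /VW[].
  have VC := coset_rstable VU (C := C); have sV := CO_subgroup V.
  have fV : finite_set (lcosets V (sval C)).
    by apply: finite_coset => //; exact: CO_open.
  have sub : lcosets V (nzset (psi O (bicoset C))) `<=` lcosets V (sval C).
    move=> _ [x px <-]; exists x => //; apply: contrapT => xC; move: px.
    by rewrite /nzset /= psi_bicoset memNset// mulr0 eqxx.
  split => //.
  + move=> x k _ Vk; rewrite !psi_bicoset; congr (_ * (nat_of_bool _)%:R).
    apply/idP/idP => /set_mem xC; apply/mem_set; last exact: VC.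
    rewrite -[x](mulgK k); apply: VC => //.
    by case: sV => _ _; exact.
  + exact: sub_finite_set fV.
  rewrite theta_bi_bicoset// (theta_cosetE dM C VU Vm).
  rewrite (@csum_supp _ _ V _ (lcosets V (sval C)))//; last 2 first.
  + move=> _ [x px <-]; apply: sub; exists x => //.
    by apply: contraNN px => /eqP ->; rewrite scale0r.
  + by move=> _ [x _ <-]; exists x.
  rewrite (relindex_sub hmu VU) invfM mulrC -scalerA; congr (_ *: _).
  rewrite (fsbig_linear (f := fun v => (relindex O U)^-1 *: v)); last 2 first.
  + by move=> a u v; rewrite scalerDr !scalerA mulrC.
  + exact: finite_setIl.
  apply: eq_fsbigr => D /set_mem DC; rewrite psi_bicoset mem_set ?mulr1.
    by rewrite scalerA mulVf ?scale1r// gt_eqF// (relindex_gt0 hmu).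
  exact: (rep_mem sV VC).
Qed.

End PsiFacts.

(** * Equivariant endomorphisms of permutation modules *)

Section PermModule.
Variables (G : topologicalGroupType) (n : nat) (U : 'I_n -> CO G).
Implicit Types (g h : G) (i j : 'I_n).

Definition pts := cosets_sum (fun i => U i : set G).
HB.instance Definition _ := Choice.on pts.
Definition pmod := permQ (fun i => U i : set G).
HB.instance Definition _ := LeftGModule.on pmod.

Definition mkpt i g : pts := @Tagged _ i (fun i => cosets (U i : set G)) (mkcoset (U i) g).

Definition vec (x : pts) : pmod := delta x.
Definition coord (x : pts) (u : pmod) : rat^o := sval u x.

Lemma coord_linear x : linear (coord x).
Proof. by []. Qed.

Lemma mkpt_eqP i g h : mkpt i g = mkpt i h <-> lcoset g (U i) = lcoset h (U i).
Proof.
split=> [/eqP|e]; last by congr Tagged; exact: cosets_eq.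
by rewrite eq_Tagged /= => /eqP/(congr1 (fun C : cosets (U i) => sval C)).
Qed.

Lemma mkpt_rep i g : mkpt i (rep (lcoset g (U i))) = mkpt i g.
Proof. by apply/mkpt_eqP; apply: lcoset_rep; exact: CO_subgroup. Qed.

Lemma mkptM i g k : (U i : set G) k -> mkpt i (g * k)%g = mkpt i g.
Proof.
move=> Uk; apply/mkpt_eqP/lcoset_eqP; first exact: CO_subgroup.
by exists k.
Qed.

Lemma ptsP (x : pts) : exists i g, x = mkpt i g.
Proof.
case: x => i C; have [g Cg] := cosetsP C; exists i, g.
by congr Tagged; exact: cosets_eq.
Qed.

Lemma lmul_mkpt g i h : cosets_sum_lmul g (mkpt i h) = mkpt i (g * h)%g.
Proof. by congr Tagged; apply: cosets_eq; rewrite /= lcosetM. Qed.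

Lemma lact_vec g i h : lact g (vec (mkpt i h)) = vec (mkpt i (g * h)%g).
Proof. by rewrite /vec -lmul_mkpt; exact: permQ_lact_delta. Qed.

Lemma pmod_eq_lin (W : lmodType rat) (f g : pmod -> W) : linear f -> linear g ->
  (forall x, f (vec x) = g (vec x)) -> f =1 g.
Proof. exact: freeQ_ind_lin. Qed.

Lemma coord_vec x y : coord x (vec y) = (y == x)%:R.
Proof. by []. Qed.

Lemma pmod_eq (u v : pmod) : (forall x, coord x u = coord x v) -> u = v.
Proof. exact: freeQP. Qed.

Lemma coord_lact g i h u : coord (mkpt i (g * h)%g) (lact g u) = coord (mkpt i h) u.
Proof.
move: u; apply: (pmod_eq_lin (f := fun u => coord _ (lact g u))) => [a u v|a u v|y].
- by rewrite lact_linear coord_linear.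
- by rewrite coord_linear.
have [j [k ->]] := ptsP y; rewrite lact_vec !coord_vec; congr ((nat_of_bool _)%:R).
rewrite -!lmul_mkpt; apply/eqP/eqP => [|->//].
have lK z : cosets_sum_lmul g^-1%g (cosets_sum_lmul g z : pts) = z.
  by have [l [m ->]] := ptsP z; rewrite !lmul_mkpt mulKg.
by move=> /(congr1 (cosets_sum_lmul g^-1%g)); rewrite !lK.
Qed.

Lemma finite_supp (u : pmod) : finite_set [set x | coord x u != 0].
Proof. by case: u => f /= /asboolP. Qed.

Lemma lin_coord (W : lmodType rat) (f : pmod -> W) u : linear f ->
  f u = \sum_(x \in [set: pts]) coord x u *: f (vec x).
Proof.
move=> fL; rewrite -/(lext (fun x => f (vec x)) u).
move: u; apply: pmod_eq_lin => //; first exact: lext_linear.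
by move=> x; rewrite lext_delta.
Qed.

(** Lifts a sum over the basis to sums over the group, orbit by orbit, where inversion is
    available. *)
Lemma fsum_orbits (W : lmodType rat) (F : pts -> W) :
  finite_set [set x | F x != 0] ->
  \sum_(x \in [set: pts]) F x = \sum_(i < n) csum (U i) setT (fun g => F (mkpt i g)).
Proof.
move=> fF; set A := [set x | _] in fF.
rewrite -(@fsbig_widen _ _ _ _ A setT)//; last first.
  by move=> x [_ /negP] /=; rewrite negbK => /eqP.
rewrite (fsbig_partition (fun x : pts => tag x))//.
rewrite (@fsbig_widen _ _ _ _ _ setT)//; last first.
  move=> i [_ nA] /=; rewrite (_ : _ `&` _ = set0) ?fsbig_set0//.
  by apply/seteqP; split=> // x [Ax /= xi]; apply: nA; exists x.
rewrite (_ : [set: 'I_n] = [set` xpredT]); last by apply/seteqP.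
rewrite -(@bigfs _ _ _ _ (index_enum 'I_n))//; last first.
- by move=> i _; rewrite mem_index_enum.
- exact: index_enum_uniq.
apply: eq_bigr => i _.
transitivity (\sum_(x \in [set x : pts | tag x = i]) F x).
  apply: fsbig_widen => [x []//|x [/= xi nx]].
  by apply: contrapT => /eqP Fx; apply: nx.
rewrite (@reindex_fsbig _ _ _ _ _ (fun C : cosets (U i : set G) =>
  @Tagged _ i (fun i => cosets (U i : set G)) C : pts) [set C | sval C `<=` setT]); last first.
  split=> //.
    by move=> C D _ _ /eqP; rewrite eq_Tagged => /eqP.
  by move=> [j C] /= <-; exists C.
rewrite /csum -fsum_cosets//; last exact: CO_subgroup.
apply: eq_fsbigr => C _; congr F; congr Tagged; apply: cosets_eq => /=.
by have [g ->] := cosetsP C; rewrite lcoset_rep//; exact: CO_subgroup.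
Qed.

Lemma finite_orbit (W : lmodType rat) (F : pts -> W) i :
  finite_set [set x | F x != 0] ->
  finite_set (lcosets (U i) (nzset (fun g => F (mkpt i g)))).
Proof.
move=> fF; apply: (@sub_finite_set _ _ ((fun x : pts => sval (tagged x)) @` [set x | F x != 0])).
  by move=> _ [g Fg <-]; exists (mkpt i g).
exact: finite_image.
Qed.

Lemma finite_orbits (W : lmodType rat) (F : pts -> W) :
  (forall i, finite_set (lcosets (U i) (nzset (fun g => F (mkpt i g))))) ->
  finite_set [set x | F x != 0].
Proof.
move=> fF; apply: (@sub_finite_set _ _ (\bigcup_i
   ((fun D => mkpt i (rep D)) @` (lcosets (U i) (nzset (fun g => F (mkpt i g))))))).
  move=> x Fx; have [i [g xg]] := ptsP x; exists i => //.
  exists (lcoset g (U i)); last by rewrite mkpt_rep.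
  by exists g => //; rewrite /nzset /= -xg.
apply: bigcup_finite => // i _; exact: finite_image.
Qed.

(** * The mass transport principle for an invariant kernel with finite columns *)

Section MassTransport.
Variables (R : realType) (O : CO G).
Variable mu : {measure set (borel G) -> \bar R}.
Hypotheses (uG : unimodular R G) (hmu : normalized_haar O mu).
Variable K : pts -> pts -> rat^o.
Hypothesis K_inv : forall g i h j k,
  K (mkpt i (g * h)%g) (mkpt j (g * k)%g) = K (mkpt i h) (mkpt j k).
Hypothesis K_fin : forall j, finite_set [set x | K x (mkpt j 1%g) != 0].

Let KV i j g : K (mkpt i g^-1%g) (mkpt j 1%g) = K (mkpt i 1%g) (mkpt j g).
Proof. by rewrite -(K_inv g) mulgV mulg1. Qed.

(** By invariance, inverting the argument of a column through the base point of orbit j gives a row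
    through the base point of orbit i. So [csum_inv] yields both the finiteness of the row and the
    exchange of weights. *)
Let mass_ij i j :
  finite_set (lcosets (U j) (nzset (fun g => K (mkpt i 1%g) (mkpt j g)))) /\
  relindex O (U j) *: csum (U i) setT (fun g => K (mkpt i g) (mkpt j 1%g)) =
  relindex O (U i) *: csum (U j) setT (fun g => K (mkpt i 1%g) (mkpt j g)).
Proof.
have := @csum_inv R G O mu uG hmu _ (U i) (U j) (fun g => K (mkpt i g) (mkpt j 1%g)).
have -> : (fun x : G => K (mkpt i x^-1%g) (mkpt j 1%g)) = (fun g => K (mkpt i 1%g) (mkpt j g)).
  by apply/funext => g; rewrite KV.
apply.
- by move=> x k _ Uk; rewrite mkptM.
- by move=> x k _ Uk; rewrite mkptM.
- exact: finite_orbit (K_fin j).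
Qed.

Lemma row_finite i : finite_set [set y | K (mkpt i 1%g) y != 0].
Proof. by apply: finite_orbits => j; have [] := mass_ij i j. Qed.

Lemma mass_transport :
  \sum_(j < n) relindex O (U j) *: (\sum_(x \in [set: pts]) K x (mkpt j 1%g)) =
  \sum_(i < n) relindex O (U i) *: (\sum_(y \in [set: pts]) K (mkpt i 1%g) y).
Proof.
under eq_bigr => j _ do rewrite (fsum_orbits (F := K^~ _) (K_fin j)) scaler_sumr.
under [RHS]eq_bigr => i _ do rewrite (fsum_orbits (F := K _) (row_finite i)) scaler_sumr.
rewrite exchange_big /=; apply: eq_bigr => i _; apply: eq_bigr => j _.
by have [] := mass_ij i j.
Qed.

End MassTransport.
End PermModule.

(** Stands for letting eps tend to 0. The restriction to eps at most 1 is there because the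
    estimates to come bound powers of eps by eps. *)
Lemma small_le0 (c x : rat) : (forall eps, 0 < eps -> eps <= 1 -> x <= c * eps) -> x <= 0.
Proof.
move=> h; rewrite leNgt; apply/negP => x0.
have c0 : 0 < c by have := lt_le_trans x0 (h 1 ltr01 (lexx _)); rewrite mulr1.
(* This choice makes the bound at most half of [x]. *)
pose eps := Num.min 1 (x / (c + c)).
have e0 : 0 < eps by rewrite lt_min ltr01 divr_gt0// addr_gt0.
have e1 : eps <= 1 by rewrite ge_min lexx.
have := h _ e0 e1; rewrite leNgt => /negP; apply.
apply: (@le_lt_trans _ _ (c * (x / (c + c)))).
  by rewrite (ler_wpM2l (ltW c0))// /eps ge_min lexx orbT.
have -> : c * (x / (c + c)) = x / 2.
  by field; lra.
lra.
Qed.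

(** A nonnegative potential cannot lose a fixed amount at every step. One good index is all that is
    asked for, without any rate of convergence. *)
Lemma descent_small (Phi r : nat -> rat) : (forall k, 0 <= Phi k) ->
  (forall k, Phi k.+1 <= Phi k - r k) ->
  forall eps, 0 < eps -> exists k, r k < eps.
Proof.
move=> P0 PS eps e0; apply: contrapT => /forallNP nr.
have re k : eps <= r k by rewrite leNgt; apply/negP; exact: nr.
have Pk k : Phi k <= Phi 0 - eps *+ k.
  elim: k => [|k IH]; first by rewrite subr0.
  rewrite (le_trans (PS k))// mulrSr opprD addrA lerD// lerN2; exact: re.
have [k kP] : exists k : nat, Phi 0 < eps *+ k.
  exists (Num.bound (Phi 0 / eps)).
  by rewrite -mulr_natl -ltr_pdivrMr// archi_boundP// divr_ge0// ltW.
have := P0 k; have := Pk k; lra.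
Qed.

(** * The standard inner product, adjoints and boundedness *)

Section InnerProduct.
Variables (G : topologicalGroupType) (n : nat) (U : 'I_n -> CO G).
Notation F := (pmod U).
Implicit Types (g h : G) (i j : 'I_n) (u v w : F).

Definition dot u v : rat := \sum_(x \in [set: pts U]) coord x u * coord x v.

Lemma dotE u v : dot u v = lext (fun x => coord x v) u.
Proof. by []. Qed.

Lemma dot_linearl v : linear (fun u => dot u v : rat^o).
Proof. exact: (lext_linear (V := rat^o)). Qed.

Lemma dotC u v : dot u v = dot v u.
Proof. by apply: eq_fsbigr => x _; rewrite mulrC. Qed.

Lemma dot_linearr u : linear (dot u : F -> rat^o).
Proof. by move=> a v w; rewrite !(dotC u) dot_linearl. Qed.

Lemma dot_vecl x v : dot (vec x) v = coord x v.
Proof. by rewrite dotE /vec (lext_delta (V := rat^o)). Qed.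

Lemma dot_vecr x v : dot v (vec x) = coord x v.
Proof. by rewrite dotC dot_vecl. Qed.

Lemma dotDr u v w : dot w (u + v) = dot w u + dot w v.
Proof. exact: (linD (dot_linearr w)). Qed.
Lemma dotBl u v w : dot (u - v) w = dot u w - dot v w.
Proof. exact: (linB (dot_linearl w)). Qed.
Lemma dotBr u v w : dot w (u - v) = dot w u - dot w v.
Proof. exact: (linB (dot_linearr w)). Qed.
Lemma dotZl a u v : dot (a *: u) v = a * dot u v.
Proof. exact: (linZ (dot_linearl v)). Qed.
Lemma dotZr a u v : dot u (a *: v) = a * dot u v.
Proof. exact: (linZ (dot_linearr u)). Qed.

Lemma dot_ge0 u : 0 <= dot u u.
Proof. by apply: fsumr_ge0 => x _; exact: sqr_ge0. Qed.

(** Expands the square of eta u - v. The free weight replaces the square roots of the Cauchy-Schwarz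
    inequality, which the rationals lack. *)
Lemma dot_amgm eta u v : 0 < eta -> 2 * `|dot u v| <= eta * dot u u + eta^-1 * dot v v.
Proof.
move=> e0.
have h w : 2 * dot w v <= eta * dot w w + eta^-1 * dot v v.
  have := dot_ge0 (eta *: w - v).
  rewrite dotBl !dotBr !dotZl !dotZr (dotC v w).
  have -> : eta * (eta * dot w w) - eta * dot w v - (eta * dot w v - dot v v) =
    eta * (eta * dot w w + eta^-1 * dot v v - 2 * dot w v).
    by field; lra.
  by rewrite pmulr_rge0// subr_ge0.
have [d0|d0] := ler0P (dot u v); last exact: h.
have := h (-1 *: u); rewrite !dotZl dotZr !mulN1r opprK; exact.
Qed.

Lemma dot_lact g u v : dot (lact g u) (lact g v) = dot u v.
Proof.
move: u; apply: (pmod_eq_lin (W := rat^o)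
  (f := fun u => dot (lact g u) (lact g v)) (g := fun u => dot u v)).
- by move=> a u w; rewrite lact_linear dot_linearl.
- exact: dot_linearl.
by move=> x; have [i [h ->]] := ptsP x; rewrite lact_vec !dot_vecl coord_lact.
Qed.

Lemma dot_inj v w : (forall u, dot u v = dot u w) -> v = w.
Proof. by move=> vw; apply: pmod_eq => x; rewrite -!dot_vecl. Qed.

Definition adjoint (a b : F -> F) := forall u v, dot (a u) v = dot u (b v).

Lemma adjointC a b : adjoint a b -> adjoint b a.
Proof. by move=> ab u v; rewrite dotC -ab dotC. Qed.

Lemma equivariant_kernel (a : F -> F) g i h j k : equivariant_linear a ->
  coord (mkpt U i (g * h)%g) (a (vec (mkpt U j (g * k)%g))) =
  coord (mkpt U i h) (a (vec (mkpt U j k))).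
Proof. by move=> [aL aG]; rewrite -lact_vec aG coord_lact. Qed.

Definition l1 u : rat := \sum_(x \in [set: pts U]) `|coord x u|.

Lemma l1_ge0 u : 0 <= l1 u.
Proof. exact: fsumr_ge0. Qed.

Lemma l1_sub u (A : {fset pts U}) : \sum_(x <- A) `|coord x u| <= l1 u.
Proof.
pose B := fset_set [set x | coord x u != 0].
rewrite /l1 (fsbigTE (A `|` B)%fset); last first.
  move=> x; rewrite in_fsetU negb_or => /andP[_].
  rewrite in_fset_set; last exact: finite_supp.
  by rewrite notin_setE /= => /negP; rewrite negbK => /eqP ->; rewrite normr0.
rewrite (big_fsetID _ (mem A))/= [X in _ <= X + _](_ : _ = \sum_(x <- A) `|coord x u|).
  by rewrite lerDl sumr_ge0.
apply: eq_fbigl => x; rewrite !inE /=.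
by case: (_ \in _); rewrite ?andbT ?andbF ?orbT.
Qed.

(** The norm is invariant under translation, so every basis vector behaves like one of the finitely
    many base points. *)
Lemma l1_vec_bound (a : F -> F) : equivariant_linear a ->
  forall y, l1 (a (vec y)) <= \sum_(j < n) l1 (a (vec (mkpt U j 1%g))).
Proof.
move=> [aL aG] y; have [j [g ->]] := ptsP y.
rewrite (bigD1 j)//= -[mkpt U j g]/(mkpt U j g) -{1}[g]mulg1 -lact_vec aG.
have -> : l1 (lact g (a (vec (mkpt U j 1%g)))) = l1 (a (vec (mkpt U j 1%g))).
  rewrite /l1 (@reindex_fsbigT _ _ _ _ _ (cosets_sum_lmul g : pts U -> pts U)).
    apply: eq_fsbigr => x _; have [i [h ->]] := ptsP x.
    by rewrite lmul_mkpt coord_lact.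
  exists (cosets_sum_lmul g^-1%g) => x; have [i [h ->]] := ptsP x.
    by rewrite !lmul_mkpt mulKg.
  by rewrite !lmul_mkpt mulVKg.
by rewrite lerDl sumr_ge0// => i _; exact: l1_ge0.
Qed.

(* Schur test: the row and column sums of |a| are bounded, being constant on orbits. *)
Lemma dot_bounded (a b : F -> F) : equivariant_linear a -> equivariant_linear b ->
  adjoint a b -> exists2 C, 0 < C & forall u, dot (a u) (a u) <= C * dot u u.
Proof.
move=> ea eb ab; pose B := 1 + \sum_(j < n) l1 (a (vec (mkpt U j 1%g))) +
  \sum_(j < n) l1 (b (vec (mkpt U j 1%g))).
have B0 : 0 < B.
  by rewrite /B -addrA ltr_wpDr// addr_ge0// sumr_ge0// => i _; exact: l1_ge0.
have aB y : l1 (a (vec y)) <= B.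
  apply: (le_trans (l1_vec_bound ea y)); rewrite /B addrAC lerDr.
  by rewrite addr_ge0// sumr_ge0// => i _; exact: l1_ge0.
have bB y : l1 (b (vec y)) <= B.
  apply: (le_trans (l1_vec_bound eb y)); rewrite /B lerDr.
  by rewrite addr_ge0// sumr_ge0// => i _; exact: l1_ge0.
(* A matrix entry k enters through 2pqk <= (p^2 + q^2)|k|. The p^2 part is summed along a column of
   [a], the q^2 part along a row of [a], which is a column of [b]. *)
have key u v : 2 * dot (a u) v <= B * (dot u u + dot v v).
  pose A := fsupp (u : freeQ _); pose D := fsupp (v : freeQ _).
  have dE w z (E : {fset pts U}) : (fsupp (w : freeQ _) `<=` E)%fset ->
      dot w z = \sum_(x <- E) coord x w * coord x z.
    by move=> wE; rewrite dotE (lextE _ wE).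
  have kE : dot (a u) v =
      \sum_(y <- A) \sum_(x <- D) coord y u * (coord x v * coord x (a (vec y))).
    transitivity (\sum_(y <- A) coord y u * dot (a (vec y)) v).
      pose fv (u : F) : rat^o := dot (a u) v.
      have fL : linear fv by move=> c u1 u2; rewrite /fv ea.1 dot_linearl.
      rewrite -/(fv u) (lin_coord u fL).
      by rewrite -[LHS]/(lext (fun x => fv (vec x)) u) (lextE _ (fsubset_refl _)).
    apply: eq_bigr => y _; rewrite dotC (dE _ _ D)// mulr_sumr.
    by [].
  rewrite kE mulr_sumr.
  have -> : dot u u = \sum_(y <- A) coord y u ^+ 2 by rewrite (dE _ _ A).
  have -> : dot v v = \sum_(x <- D) coord x v ^+ 2 by rewrite (dE _ _ D).
  rewrite mulrDr !mulr_sumr.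
  apply: (@le_trans _ _ (\sum_(y <- A) \sum_(x <- D)
      (coord y u ^+ 2 * `|coord x (a (vec y))| + coord x v ^+ 2 * `|coord x (a (vec y))|))).
    apply: ler_sum => y _; rewrite mulr_sumr; apply: ler_sum => x _.
    rewrite -mulrDl; move: (coord y u : rat) (coord x v : rat) (coord x (a (vec y)) : rat) => p q k.
    rewrite !mulrA; apply: (@le_trans _ _ (`|2 * p * q| * `|k|)).
      by rewrite -normrM ler_norm.
    rewrite ler_wpM2r//.
    rewrite ler_norml -subr_ge0 opprK -(subr_ge0 (2 * p * q)).
    have -> : p ^+ 2 + q ^+ 2 - 2 * p * q = (p - q) ^+ 2.
      by rewrite sqrrB -mulrA mulr_natl addrAC.
    have -> : 2 * p * q + (p ^+ 2 + q ^+ 2) = (p + q) ^+ 2.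
      by rewrite sqrrD -mulrA mulr_natl addrCA addrA.
    by rewrite !sqr_ge0.
  under eq_bigr => y _ do rewrite big_split.
  rewrite big_split /=; apply: lerD.
    apply: ler_sum => y _; rewrite -mulr_sumr mulrC ler_wpM2r ?sqr_ge0//.
    exact: le_trans (l1_sub _ _) (aB y).
  rewrite exchange_big /=; apply: ler_sum => x _; rewrite -mulr_sumr mulrC ler_wpM2r ?sqr_ge0//.
  under eq_bigr => y _ do rewrite -dot_vecr ab dot_vecl.
  exact: le_trans (l1_sub _ _) (bB x).
exists (B ^+ 2); first exact: exprn_gt0.
(* With this scaling the term in |a u|^2 on the right is half of the left side and can be absorbed,
   leaving the constant B^2. *)
move=> u; have := key u (B^-1 *: a u); rewrite !dotZl !dotZr.
have -> : B * (dot u u + B^-1 * (B^-1 * dot (a u) (a u))) =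
  B * dot u u + B^-1 * dot (a u) (a u) by rewrite mulrDr mulVKf ?gt_eqF.
rewrite mulr2n mulrDl mul1r lerD2r => h.
by rewrite expr2 -mulrA -ler_pdivrMl.
Qed.

End InnerProduct.

(** * Positivity of the trace of an idempotent *)

Section Kaplansky.
Variables (R : realType) (G : topologicalGroupType) (O : CO G).
Variable mu : {measure set (borel G) -> \bar R}.
Hypotheses (uG : unimodular R G) (hmu : normalized_haar O mu).
Variables (n : nat) (U : 'I_n -> CO G).
Notation F := (pmod U).
Notation bp i := (mkpt U i 1%g).
Implicit Types (g h : G) (i j : 'I_n) (u v w : F).

Lemma equivariant_comp (a b : F -> F) : equivariant_linear a ->
  equivariant_linear b -> equivariant_linear (fun u => a (b u)).
Proof.
by move=> [aL aG] [bL bG]; split=> [c u v|g u]; rewrite ?bL ?aL ?bG ?aG.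
Qed.

Lemma adjoint_exists (a : F -> F) : equivariant_linear a ->
  exists2 b, equivariant_linear b & adjoint a b.
Proof.
move=> ea; have [aL aG] := ea.
have fr i : finite_set [set y | (coord (bp i) (a (vec y)) : rat^o) != 0].
  apply: (@row_finite _ _ _ _ _ _ uG hmu (fun x y => coord x (a (vec y)))).
    by move=> g k h l m; exact: equivariant_kernel.
  by move=> j; exact: finite_supp.
(* Mass transport gives finite rows at base points; the other rows are their translates. *)
have fx x : finite_set [set y | (coord x (a (vec y)) : rat^o) != 0].
  have [i [g ->]] := ptsP x.
  apply: (@sub_finite_set _ _ (cosets_sum_lmul g @`
    [set y | (coord (bp i) (a (vec y)) : rat^o) != 0])); last first.
    exact: finite_image.
  move=> y /=; have [j [h ->]] := ptsP y => ne; exists (mkpt U j (g^-1 * h)%g).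
    by rewrite /= -(equivariant_kernel g) // mulg1 mulVKg.
  by rewrite lmul_mkpt mulVKg.
pose row x : F := exist (fun f => finsupp_pred f) (fun y => coord x (a (vec y)))
  (introT (asboolP _) (fx x)).
pose b : F -> F := lext row.
have bL : linear b by exact: lext_linear.
have ab : adjoint a b.
  move=> u v; move: u; apply: (pmod_eq_lin (W := rat^o) (f := fun u => dot (a u) v)
    (g := fun u => dot u (b v))) => [c u w|c u w|y].
  - by rewrite aL dot_linearl.
  - by rewrite dot_linearl.
  move: v; apply: (pmod_eq_lin (W := rat^o)) => [c u w|c u w|x].
  - by rewrite dot_linearr.
  - by rewrite bL dot_linearr.
  by rewrite dot_vecr dot_vecl /b /vec lext_delta.
exists b => //; split => // g v; apply: dot_inj => u.
rewrite -ab -[u](lact1) -(mulgV g) lactM.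
by rewrite aG !dot_lact ab.
Qed.

Definition tau (a : F -> F) : rat :=
  \sum_(j < n) relindex O (U j) * coord (bp j) (a (vec (bp j))).

Lemma tauC (a b : F -> F) : equivariant_linear a -> equivariant_linear b ->
  tau (fun u => a (b u)) = tau (fun u => b (a u)).
Proof.
move=> ea eb.
have comp (c d : F -> F) (x y : pts U) : linear c -> coord y (c (d (vec x))) =
    \sum_(z \in [set: pts U]) (coord z (d (vec x)) : rat) * coord y (c (vec z)) :> rat^o.
  by move=> cL; rewrite (@lin_coord _ _ _ (rat^o) (fun u => coord y (c u)))// => k u v; rewrite cL.
(* The sum of column y of this kernel is the diagonal entry of ab at y, and the sum of row x is that
   of ba at x. *)
pose K x y : rat^o := coord x (b (vec y)) * coord y (a (vec x)).
have := @mass_transport _ _ U _ _ _ uG hmu K.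
have Kinv g i h j k : K (mkpt U i (g * h)%g) (mkpt U j (g * k)%g) =
    K (mkpt U i h) (mkpt U j k).
  by rewrite /K !equivariant_kernel.
have Kfin j : finite_set [set x | K x (bp j) != 0].
  apply: sub_finite_set (finite_supp (b (vec (bp j)))) => x /=.
  by apply: contraNN; rewrite /K => /eqP ->; rewrite mul0r.
move=> /(_ Kinv Kfin) e.
rewrite /tau.
under eq_bigr => j _ do rewrite (comp a b _ _ ea.1).
under [RHS]eq_bigr => j _ do rewrite (comp b a _ _ eb.1).
rewrite [LHS]e; apply: eq_bigr => j _; congr (_ * _); apply: eq_fsbigr => x _.
by rewrite /K mulrC.
Qed.

Variables (e : F -> F).
Hypotheses (ee : equivariant_linear e) (ide : forall u, e (e u) = e u).

Let w j := relindex O (U j).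
Let w0 j : 0 < w j. Proof. exact: (relindex_gt0 hmu). Qed.

(** * Polynomial approximation of the orthogonal projection onto the range of [e] *)

Section Approx.
Variable e' : F -> F.
Hypotheses (ee' : equivariant_linear e') (ade : adjoint e e').

(* The iterates [v] of [1 - t e e'] are self-adjoint and [e' v] tends to [0] on
   each vector, so [f = 1 - v] approximates the orthogonal projection onto the
   range of [e]. *)
Lemma approx_projection eps : 0 < eps -> exists f v : F -> F,
  [/\ [/\ equivariant_linear f, equivariant_linear v & forall u, u = f u + v u],
      adjoint f f, adjoint v v, forall u, e (f u) = f u
    & forall j, dot (e' (v (vec (bp j)))) (e' (v (vec (bp j)))) <= eps].
Proof.
move=> eps0; have [C C0 eC] := dot_bounded ee ee' ade.
have [[eL eG] [eL' eG']] := (ee, ee').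
(* One step changes |x|^2 by -2t|e' x|^2 + t^2|e e' x|^2. As |e y|^2 <= C|y|^2, this [t] makes the
   change at most -t|e' x|^2. *)
pose t := C^-1; have t0 : 0 < t by rewrite invr_gt0.
pose st u : F := u - t *: e (e' u).
have stE : equivariant_linear st.
  split=> [c x y|g x]; rewrite /st.
    by rewrite eL' eL scalerDr opprD addrACA scalerA mulrC -scalerA scalerBr.
  by rewrite eG' eG -lactZ -(linB (@lact_linear G F g)).
have stA : adjoint st st.
  by move=> x y; rewrite /st dotBl dotBr dotZl dotZr ade (adjointC ade).
pose v k u : F := iter k st u.
have vE k : equivariant_linear (v k).
  elim: k => [|k IH]; first by split.
  exact: (equivariant_comp stE IH).
have vA k : adjoint (v k) (v k).
  elim: k => [|k IH] x y; first by [].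
  by rewrite [in RHS]/v iterSr -[LHS]/(dot (st (v k x)) y) stA IH.
have fE k : equivariant_linear (fun u => u - v k u).
  have [vL vG] := vE k; split=> [c x y|g x].
    by rewrite vL opprD addrACA scalerBr.
  by rewrite vG -(linB (@lact_linear G F g)).
(* Each step adds t e e' v_k u, an element of the range of [e]. *)
have ef k u : e (u - v k u) = u - v k u.
  elim: k => [|k IH]; first by rewrite subrr (lin0 eL).
  rewrite -[v k.+1 u]/(v k u - t *: e (e' (v k u))) opprB addrCA.
  by rewrite (linD eL) (linZ eL) ide IH.
pose r k := \sum_(j < n) t * dot (e' (v k (vec (bp j)))) (e' (v k (vec (bp j)))).
(* The potential sums over all base points, so that a single [k] serves them all. *)
pose Phi k := \sum_(j < n) dot (v k (vec (bp j))) (v k (vec (bp j))).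
have [k rk] : exists k, r k < t * eps.
  apply: (@descent_small Phi) => [k|k|]; last exact: mulr_gt0.
    by apply: sumr_ge0 => j _; exact: dot_ge0.
  rewrite /Phi /r -sumrB; apply: ler_sum => j _.
  rewrite -[v k.+1 _]/(st (v k (vec (bp j)))); move: (v k _) => x.
  rewrite /st dotBl !dotBr !dotZl !dotZr ade (dotC x) ade.
  have := eC (e' x); have := dot_ge0 (e' x).
  set A := dot (e' x) (e' x); set B := dot (e _) _ => A0 BA.
  have : t * B <= A by rewrite /t -ler_pdivlMl ?invr_gt0 ?invrK.
  nra.
exists (fun u => u - v k u), (v k); split.
- by split=> // u; rewrite subrK.
- by move=> x y; rewrite dotBl dotBr vA.
- exact: vA.
- exact: ef.
move=> j; rewrite -(ler_pM2l t0); apply: le_trans (ltW rk).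
rewrite /r (bigD1 j)//= lerDl sumr_ge0// => i _.
by rewrite mulr_ge0 ?dot_ge0// ltW.
Qed.

(** The two error terms come from v e and from v f = v e f. Moving [v] and [e] across the inner
    product leaves [e'] applied to [v], the quantity known to be small. *)
Lemma tau_approx (f v : F -> F) :
    [/\ equivariant_linear f, equivariant_linear v & forall u, u = f u + v u] ->
    adjoint f f -> adjoint v v -> (forall u, e (f u) = f u) ->
  tau e = \sum_(j < n) w j * (dot (f (vec (bp j))) (f (vec (bp j))) +
    dot (f (vec (bp j))) (e' (v (vec (bp j)))) + dot (vec (bp j)) (e' (v (vec (bp j))))).
Proof.
move=> [ef ev fv] fA vA efK.
have -> : tau e = tau (fun u => e (f u)) +
    \sum_(j < n) w j * dot (vec (bp j)) (e' (v (vec (bp j)))).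
  rewrite (tauC ee ef) /tau -big_split /=; apply: eq_bigr => j _.
  rewrite -mulrDr; congr (_ * _); rewrite {1}(fv (e _)) -!dot_vecl dotDr.
  by rewrite -[in X in _ + X]vA -ade (dotC (v _)) ade dotC -ade dotC.
rewrite /tau -big_split /=; apply: eq_bigr => j _; rewrite -mulrDr; congr (_ * (_ + _)).
rewrite efK -dot_vecr {2}(fv (vec (bp j))) dotDr; congr (_ + _).
by rewrite -{1}efK ade.
Qed.

Let S := \sum_(j < n) w j.

Lemma tau_ge eps (f v : F -> F) : 0 < eps -> eps <= 1 ->
    [/\ equivariant_linear f, equivariant_linear v & forall u, u = f u + v u] ->
    adjoint f f -> adjoint v v -> (forall u, e (f u) = f u) ->
    (forall j, dot (e' (v (vec (bp j)))) (e' (v (vec (bp j)))) <= eps ^+ 2) ->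
  (\sum_(j < n) w j * dot (f (vec (bp j))) (f (vec (bp j)))) <= 2 * tau e + 4 * S * eps.
Proof.
move=> e0 e1 h fA vA efK small.
rewrite (tau_approx h)// /S !mulr_sumr mulr_suml -big_split /=.
apply: ler_sum => j _; have := small j.
set d := vec (bp j).
(* Weight 1 bounds 2|p| by N plus a small term, which uses up one of the two copies of N and
   explains the factor 2 before [tau e]. Weight [eps] balances the norm 1 of [d] against a vector of
   squared norm at most eps^2. *)
have := dot_amgm (f d) (e' (v d)) ltr01; have := dot_amgm d (e' (v d)) e0.
have -> : dot d d = 1 by rewrite dot_vecl coord_vec eqxx.
rewrite invr1 !mul1r mulr1.
set N := dot (f d) (f d); set p := dot (f d) _; set q := dot d _; set r := dot (e' _) _.
move=> h1 h2 h3.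
have h4 : eps^-1 * r <= eps.
  by rewrite ler_pdivrMl// -expr2.
have h5 : eps ^+ 2 <= eps by rewrite expr2 ger_pMr.
have h6 : - p <= `|p| by rewrite -normrN ler_norm.
have h7 : - q <= `|q| by rewrite -normrN ler_norm.
have h8 : N <= 2 * (N + p + q) + 4 * eps by lra.
have := ler_wpM2l (ltW (w0 j)) h8; lra.
Qed.

End Approx.

Lemma tau_ge0 : 0 <= tau e.
Proof.
have [e' ee' ade] := adjoint_exists ee.
rewrite -oppr_le0; apply: (@small_le0 (2 * \sum_(j < n) w j)) => eps e0 e1.
have [|f [v [h fA vA efK small]]] := @approx_projection e' ee' ade (eps ^+ 2).
  exact: exprn_gt0.
have := tau_ge ade e0 e1 h fA vA efK small.
have : 0 <= \sum_(j < n) w j * dot (f (vec (bp j))) (f (vec (bp j))).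
  by apply: sumr_ge0 => j _; rewrite mulr_ge0 ?dot_ge0 ?ltW.
lra.
Qed.

(** Estimates one matrix entry of [e] by splitting the row vector as x = f x + v x: the vanishing
    trace makes f x small, and on v x the map [e] becomes [e']. Both bounds pass from base points to
    x by equivariance. *)
Lemma tau_eq0 : tau e = 0 -> forall u, e u = 0.
Proof.
move=> te; have [e' ee' ade] := adjoint_exists ee.
suff H i j h : coord (mkpt U i h) (e (vec (bp j))) = 0.
  move=> u; apply: (pmod_eq_lin (g := fun=> 0)) => [|c x y|x]; first exact: ee.1.
    by rewrite scaler0 addr0.
  have [j [g ->]] := ptsP x; rewrite -[g]mulg1 -lact_vec ee.2.
  rewrite (_ : e _ = 0) ?(lin0 (@lact_linear G F g))//.
  by apply: pmod_eq => y; have [i [h ->]] := ptsP y; rewrite H.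
set c := coord _ _; set d := vec (bp j).
suff : 2 * `|c| <= 0 by rewrite pmulr_rle0// normr_le0 => /eqP.
apply: (@small_le0 (dot (e d) (e d) + 4 * (\sum_(j < n) w j) / w i + 2)) => eps e0 e1.
(* The bound on |f x|^2 is linear in the error and gets divided by [eps] in the weighted inequality,
   so the error has to be of order eps^2. *)
pose del := eps ^+ 2.
have d0 : 0 < del by exact: exprn_gt0.
have dle : del <= eps by rewrite /del expr2 ger_pMr.
have d1 : del <= 1 by exact: le_trans e1.
have [|f [v [hh fA vA efK small]]] := @approx_projection e' ee' ade (del ^+ 2).
  exact: exprn_gt0.
have [ef ev fv] := hh.
have fs := tau_ge ade d0 d1 hh fA vA efK small.
have fi : w i * dot (f (vec (bp i))) (f (vec (bp i))) <= 4 * (\sum_(j < n) w j) * del.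
  apply: le_trans (le_trans fs _); last by rewrite te mulr0 add0r.
  rewrite (bigD1 i)//= lerDl sumr_ge0// => k _.
  by rewrite mulr_ge0 ?dot_ge0 ?ltW.
pose x := vec (mkpt U i h).
have xE : x = lact h (vec (bp i)) by rewrite lact_vec mulg1.
have fx : dot (f x) (f x) = dot (f (vec (bp i))) (f (vec (bp i))).
  by rewrite xE ef.2 dot_lact.
have rx : dot (e' (v x)) (e' (v x)) <= del ^+ 2.
  by rewrite xE ev.2 ee'.2 dot_lact; exact: small.
have cE : c = dot (e d) (f x) + dot d (e' (v x)).
  by rewrite /c -dot_vecr -/x -/d {1}(fv x) dotDr -(ade d).
have := dot_amgm (e d) (f x) e0; have := dot_amgm d (e' (v x)) e0.
have -> : dot d d = 1 by rewrite dot_vecl coord_vec eqxx.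
rewrite fx => h1 h2.
have h3 : `|c| <= `|dot (e d) (f x)| + `|dot d (e' (v x))|.
  by rewrite cE ler_normD.
have h4 : eps^-1 * dot (e' (v x)) (e' (v x)) <= eps.
  rewrite ler_pdivrMl// -expr2 -/del; apply: le_trans rx _.
  by rewrite expr2 ger_pMr.
have h5 : eps^-1 * dot (f (vec (bp i))) (f (vec (bp i))) <= 4 * (\sum_(j < n) w j) / w i * eps.
  rewrite ler_pdivrMl//.
  have -> : eps * (4 * (\sum_(j < n) w j) / w i * eps) =
      (w i)^-1 * (4 * (\sum_(j < n) w j) * del).
    by rewrite /del; ring.
  by rewrite ler_pdivlMl.
lra.
Qed.

End Kaplansky.

(** * The Hattori-Stallings rank *)

Section Discreteness.
Variable G : topologicalGroupType.

Lemma open_subgroup_sub (H K : set G) : subgroup H -> subgroup K -> open K ->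
  K `<=` H -> open H.
Proof.
by move=> sH sK oK KH; apply: (open_rstable sK oK (rstableS KH (subgroup_rstable sH))).
Qed.

Lemma pmod_discrete n (U : 'I_n -> CO G) : discrete (pmod U).
Proof.
apply: freeQ_ind => [|a u v ou ov|x].
- rewrite (_ : stabilizer _ = setT); first exact: openT.
  by apply/seteqP; split=> // g _; exact: (lin0 (@lact_linear G (pmod U) g)).
- apply: (open_subgroup_sub (stabilizer_subgroup _)
    (subgroupI (stabilizer_subgroup (u : pmod U)) (stabilizer_subgroup (v : pmod U)))).
    exact: openI.
  by move=> g [gu gv]; rewrite /stabilizer /= (@lact_linear G (pmod U)) gu gv.
- have [i [g xg]] := ptsP (x : pts U).
  apply: (open_subgroup_sub (stabilizer_subgroup _) (CO_subgroup (conjCO (U i) g^-1%g))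
    (CO_open _)).
  move=> _ [u Uu <-]; rewrite /stabilizer /= -/(vec x) xg lact_vec conjgE invgK.
  by rewrite -!mulgA mulVg mulg1 mkptM.
Qed.

End Discreteness.

Section HomFacts.
Variables (G : topologicalGroupType).

Definition mkHom (M N : leftGModType G) (f : M -> N) (fe : equivariant_linear f) :
  Defs.Hom M N := exist (fun f => @Hom_pred G M N f) f (introT (asboolP _) fe).

Lemma HomP (M N : leftGModType G) (f : Defs.Hom M N) : equivariant_linear (sval f).
Proof. by case: f => f /= /asboolP. Qed.

(** A subgroup fixing [m] fixes [f m], so both averages run over the same cosets. This will carry
    the section of the projection from P to F through [theta]. *)
Lemma theta_bi_natural (M N : leftGModType G) (dM : discrete M) (dN : discrete N)
    (f : M -> N) (b : Bi G) (m : M) :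
  equivariant_linear f -> f (theta_bi b m) = theta_bi b (f m).
Proof.
move=> [fL fG]; move: b; apply: bi_eq_lin.
- by move=> a u v; rewrite (theta_bi_linear dM) fL.
- exact: theta_bi_linear.
move=> U C; rewrite !theta_bi_bicoset//; pose K := COstab dM U m.
have KU : K `<=` U by move=> v [].
have Km : K `<=` stabilizer m by move=> v [].
have Kfm : K `<=` stabilizer (f m) by move=> v /Km; rewrite /stabilizer /= -fG => ->.
have fK : finite_set (lcosets K (sval C)).
  by apply: finite_coset; [exact: CO_subgroup|exact: CO_open].
rewrite (theta_cosetE dM C KU Km) (theta_cosetE dN C KU Kfm) (linZ fL).
rewrite /csum (fsbig_linear fL); last exact: finite_setIl.
by congr (_ *: _); apply: eq_fsbigr => D _; rewrite fG.
Qed.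

Lemma lact_bicoset g (U : CO G) (C : cosets U) :
  lact g (bicoset C) = bicoset (cosets_lmul g C).
Proof. by rewrite /bicoset -lact_bcoset; exact: bi_lactE. Qed.

End HomFacts.

(** * Comparison of [tr] with the weighted diagonal sum on F *)

Section Trace.
Variables (R : realType) (G : topologicalGroupType) (O : CO G).
Variable mu : {measure set (borel G) -> \bar R}.
Hypotheses (uG : unimodular R G) (hmu : normalized_haar O mu).
Variables (n : nat) (U : 'I_n -> CO G).
Notation F := (pmod U).
Notation bp i := (mkpt U i 1%g).
Let dF := @pmod_discrete G n U.

Lemma vec_inj : injective (@vec G n U).
Proof.
move=> x y /(congr1 (coord y)); rewrite !coord_vec eqxx.
by case: eqP => // _ /eqP; rewrite eq_sym oner_eq0.
Qed.

Lemma stabilizer_vec i g : stabilizer (vec (mkpt U i g)) = conjs (U i) g^-1%g.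
Proof.
have sU := CO_subgroup (U i).
apply/seteqP; split=> [x|_ [u Uu <-]]; rewrite /stabilizer /= lact_vec.
  move=> /vec_inj/mkpt_eqP/(lcoset_eqP _ _ sU)[u Uu ux].
  by exists u => //; rewrite conjgE invgK mulgA ux mulgK.
by rewrite conjgE invgK -!mulgA mulVg mulg1 mkptM.
Qed.

Lemma psi_equivariant (Phi : F -> Bi G) i u x : equivariant_linear Phi ->
  (U i : set G) u -> psi O (Phi (vec (bp i))) (u * x)%g = psi O (Phi (vec (bp i))) x.
Proof.
move=> [_ PG] Uu; rewrite -{1}(invgK u) -(psi_lact hmu) -PG lact_vec mulg1.
congr (psi O (Phi (vec _)) x); rewrite -[u^-1%g]mul1g mkptM//.
by case: (CO_subgroup (U i)) => _ _; exact.
Qed.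

(** The left side is the weighted trace of the endomorphism u' -> theta(Phi u' (x) u). For u = g x_i
    only orbit i contributes, and there the elements moving g x_i to x_i form U_i g^-1. On this set
    [psi] of [Phi x_i] is constant by left U_i-invariance, and the volume of the set cancels the
    weight. *)
Lemma trace_formula (Phi : F -> Bi G) u : equivariant_linear Phi ->
  \sum_(j < n) relindex O (U j) * coord (bp j) (theta_bi (Phi (vec (bp j))) u) =
  psi O (Phi u) 1%g :> rat.
Proof.
move=> eP; have [PL PG] := eP; move: u.
apply: (pmod_eq_lin (W := rat^o) (g := fun u => psi O (Phi u) 1%g)
  (f := fun u => \sum_(j < n) relindex O (U j) * coord (bp j) (theta_bi (Phi (vec (bp j))) u))).
- move=> a u v; rewrite scaler_sumr -big_split; apply: eq_bigr => j _.
  by rewrite (theta_bi_linearr dF) coord_linear mulrDr [_ *: (_ * _)]mulrCA.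
- by move=> a u v; rewrite PL (psi_linear hmu).
move=> x; have [i [g ->]] := ptsP x.
rewrite -{2}[g]mulg1 -lact_vec PG (psi_lact hmu) mulg1.
set m := vec (mkpt U i g).
have coefE j : exists2 V : CO G, V `<=` conjs (U i) g^-1%g &
    coord (bp j) (theta_bi (Phi (vec (bp j))) m) = (relindex O V)^-1 *
      csum V setT (fun x => psi O (Phi (vec (bp j))) x *
        (mkpt U i (x * g)%g == bp j)%:R : rat^o) :> rat.
  have [V0 /(_ V0)[//|Vm rV fV ->]] := theta_psi hmu dF (Phi (vec (bp j))) m.
  exists V0; first by rewrite -stabilizer_vec.
  rewrite (linZ (coord_linear _)); congr (_ * _).
  rewrite (lin_csum (coord_linear _)); last 2 first.
  - exact: CO_subgroup.
  - apply: sub_finite_set fV => _ [y py <-]; exists y => //.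
    by apply: contraNN py => /eqP ->; rewrite scale0r.
  by apply: eq_fsbigr => D _; rewrite (linZ (coord_linear _)) lact_vec.
rewrite (bigD1 i)//= big1 ?addr0 => [|j ji]; last first.
  have [V _ ->] := coefE j; rewrite /csum fsbig1 ?mulr0// => D _.
  case: eqP => [/(congr1 (fun x : pts U => tag x)) /= ij|_]; last by rewrite mulr0.
  by rewrite ij eqxx in ji.
have [V VU ->] := coefE i; set beta := Phi _.
have sU := CO_subgroup (U i); have sV := CO_subgroup V.
(* These are the elements carrying [m] to the base point; to be cut into left cosets of [V], the set
   is rewritten as a left translate of the stabilizer of [m]. *)
pose A : set G := rcoset (U i) g^-1%g.
have AE : A = lcoset g^-1%g (conjs (U i) g^-1%g).
  by rewrite /A -[X in rcoset X]lcoset1 rcoset_conjs mul1g.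
have mA y : (mkpt U i (y * g)%g == bp i) = (y \in A).
  have [_ _ UV] := sU.
  apply/eqP/idP => [/mkpt_eqP|/set_mem[u Uu <-]]; last first.
    by rewrite mulgVK -[u]mul1g mkptM.
  move=> /esym/(lcoset_eqP _ _ sU)/lcosetP; rewrite invgM mulg1 => /UV.
  rewrite invgM !invgK => Uy; apply/mem_set; exists (y * g)%g => //.
  by rewrite mulgK.
have AV : rstable A V.
  rewrite AE; apply: lcoset_rstable; apply: (rstableS VU).
  by apply: subgroup_rstable; exact: subgroup_conjs.
have fA : finite_set (lcosets V A).
  apply: finite_lcosetsCO; rewrite AE; apply: compact_lcoset.
  exact: (@CO_compact G (conjCO (U i) g^-1%g)).
have -> : csum V setT (fun y => psi O beta y * (mkpt U i (y * g)%g == bp i)%:R : rat^o) =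
    csum V A (fun=> psi O beta g^-1%g).
  rewrite (@csum_supp _ _ V _ (lcosets V A))//.
  - apply: eq_fsbigr => D /set_mem /(rep_mem sV AV) DA.
    rewrite mA mem_set// mulr1; case: DA => u Uu <-.
    exact: psi_equivariant.
  - move=> _ [y py <-]; exists y => //; apply/set_mem; rewrite -mA.
    by apply: contraNT py => /negPf ->; rewrite mulr0.
  - by move=> _ [y _ <-]; exists y.
rewrite csum_const//.
have -> : indexg A V = indexg (conjs (U i) g^-1%g) V.
  rewrite /indexg -!/(lcosets _ _) AE lcosets_lcoset [in LHS]fset_set_image.
    by rewrite card_imfset//; exact: lcoset_inj.
  exact: (finite_lcosetsCO V (@CO_compact G (conjCO (U i) g^-1%g))).
(* The index is relative to a conjugate of [U i]; by unimodularity its weight is that of [U i]. *)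
have := relindex_sub hmu (U := conjCO (U i) g^-1%g) VU.
rewrite /= (relindex_conjCO uG hmu) => ->.
have cancel (a b c : rat) : a != 0 -> b != 0 -> a * ((a * b)^-1 * (b * c)) = c.
  by move=> a0 b0; rewrite invfM -mulrA mulVKf// mulKf.
apply: cancel; first by rewrite gt_eqF// (relindex_gt0 hmu).
by rewrite pnatr_eq0 -lt0n; exact: (indexg_gt0 (conjCO (U i) g^-1%g)).
Qed.

End Trace.

(** * The rank as the trace of an idempotent *)

Section Rank.
Variables (R : realType) (G : topologicalGroupType) (O : CO G).
Variable mu : {measure set (borel G) -> \bar R}.
Hypotheses (uG : unimodular R G) (hmu : normalized_haar O mu).
Variables (P : leftGModType G) (dP : discrete P).
Variables (n : nat) (U : 'I_n -> CO G).
Notation F := (pmod U).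
Notation bp i := (mkpt U i 1%g).
Variables (f : F -> P) (q : P -> F).
Hypotheses (ef : equivariant_linear f) (eq : equivariant_linear q).
Hypothesis fqK : forall p, f (q p) = p.

Let e (u : F) : F := q (f u).

Let ee : equivariant_linear e.
Proof.
by case: ef eq => [fL fG] [qL qG]; split=> [c u v|g u]; rewrite /e ?fL ?qL ?fG ?qG.
Qed.

Lemma xi_sum (s : seq (Defs.Hom P (Bi G) * P)) p' :
  xi (\sum_(x <- s) tens x.1 x.2) p' = \sum_(x <- s) theta_bi (sval x.1 p') x.2.
Proof.
rewrite (lin_sum (xi_linear dP)).
elim: s => [|x s IH]; first by rewrite !big_nil.
by rewrite !big_cons -IH -(xi_tens dP).
Qed.

(** Valid for every decomposition of the identity, so the choice made by [xget] does not matter.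
    Composed with [q] and [f], the endomorphism of a term phi (x) p becomes u -> theta(phi(f u) (x)
    q p), whose weighted trace is tr(phi p) because f q = 1; these endomorphisms add up to [e]. *)
Lemma rank_tau (s : seq (Defs.Hom P (Bi G) * P)) :
  xi (\sum_(x <- s) tens x.1 x.2) = id ->
  \sum_(x <- s) tr O mu (sval x.1 x.2) = haar_multiple mu (tau O e).
Proof.
move=> hs.
have -> : tau O e = \sum_(x <- s) (psi O (sval x.1 x.2) 1%g : rat).
  have tf (x : Defs.Hom P (Bi G) * P) : (psi O (sval x.1 x.2) 1%g : rat) =
     \sum_(j < n) relindex O (U j) * coord (bp j) (q (theta_bi (sval x.1 (f (vec (bp j)))) x.2)).
    have [xL xG] := HomP x.1.
    have [fL fG] := ef.
    rewrite -{1}(fqK x.2) -(trace_formula uG hmu (Phi := fun u => sval x.1 (f u))); last first.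
      by split=> [c u v|g u]; rewrite ?fL ?xL ?fG ?xG.
    apply: eq_bigr => j _; congr (_ * coord _ _); apply/esym.
    exact: (theta_bi_natural dP (@pmod_discrete G n U) _ _ eq).
  under eq_bigr do rewrite tf.
  rewrite exchange_big /=; apply: eq_bigr => j _; rewrite -mulr_sumr; congr (_ * _).
  rewrite -(lin_sum (coord_linear (bp j))) -(lin_sum eq.1); congr (coord _ (q _)).
  by rewrite -xi_sum hs.
apply/funext => A; rewrite /tr /haar_multiple rmorph_sum mulr_suml.
elim: s {hs} => [|x s IH]; first by rewrite !big_nil.
by rewrite !big_cons -IH.
Qed.

(** On basis vectors, the projection of F onto Q[G/U_j] followed by the canonical map to Bi(G).
    Precomposed with [q], these maps form a dual basis with the images of the base points. *)
Let pr j (x : pts U) : Bi G :=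
  if tag x == j then bicoset (tagged x : cosets (U (tag x) : set G)) else 0.

Let Phi j : F -> Bi G := lext (pr j).

Lemma Phi_vec j x : Phi j (vec x) = pr j x.
Proof. exact: lext_delta. Qed.

Lemma Phi_equivariant j : equivariant_linear (Phi j).
Proof.
have PL : linear (Phi j) by exact: lext_linear.
split=> // g; apply: pmod_eq_lin => [a u v|a u v|x].
- by rewrite (@lact_linear G F g) PL.
- by rewrite PL (@lact_linear G (Bi G) g).
have [i [h ->]] := ptsP x; rewrite lact_vec !Phi_vec /pr /=.
case: eqP => _; last by rewrite (lin0 (@lact_linear G (Bi G) g)).
rewrite lact_bicoset; congr bicoset; apply: cosets_eq => /=.
by rewrite lcosetM.
Qed.

Lemma Phi_q_equivariant j : equivariant_linear (fun p => Phi j (q p)).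
Proof.
have [[PL PG] [qL qG]] := (Phi_equivariant j, eq).
by split=> [c u v|g u]; rewrite ?qL ?PL ?qG ?PG.
Qed.

Definition dual_basis : seq (Defs.Hom P (Bi G) * P) :=
  [seq (mkHom (Phi_q_equivariant j), f (vec (bp j))) | j <- index_enum 'I_n].

(** Provides a decomposition of the identity, without which [xget] would return its default 0. The
    check is made for all of F, where the sum equals [f u]. *)
Lemma dual_basisP : xi (\sum_(x <- dual_basis) tens x.1 x.2) = id.
Proof.
apply/funext => p; rewrite xi_sum big_map /= -[RHS]fqK.
have [fL fG] := ef.
move: (q p); apply: (pmod_eq_lin (f := fun u => \sum_(j < n) theta_bi (Phi j u) (f (vec (bp j)))))
  => [a u v|//|x].
  rewrite scaler_sumr -big_split; apply: eq_bigr => j _.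
  by rewrite (Phi_equivariant j).1 (theta_bi_linear dP).
have [i [g ->]] := ptsP x.
rewrite (bigD1 i)//= big1 ?addr0 => [|j ji]; last first.
  rewrite Phi_vec /pr /= eq_sym (negPf ji).
  exact: (lin0 (theta_bi_linear dP _)).
rewrite Phi_vec /pr eqxx (theta_bi_bicoset dP).
have sU := CO_subgroup (U i).
(* The vector [f x_i] is fixed by [U i], so the average over g U_i has a single term. *)
have Um : U i `<=` stabilizer (f (vec (bp i))).
  by move=> u Uu; rewrite /stabilizer /= -fG lact_vec mulg1 -[u]mul1g mkptM.
rewrite (theta_cosetE dP _ (@subset_refl _ _) Um).
have -> : csum (U i) (sval (tagged (mkpt U i g)))
    (fun x => lact x (f (vec (bp i)))) = lact g (f (vec (bp i))).
  by rewrite csum_self //; exact: lact_rinv.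
rewrite -relindex_nested// /relindex setIid divff ?invr1 ?scale1r.
  by rewrite -fG lact_vec mulg1.
by rewrite pnatr_eq0 -lt0n indexg_gt0.
Qed.

Lemma HS_rankE : HS_rank O mu P = haar_multiple mu (tau O e).
Proof.
rewrite /HS_rank; case: xgetP => [l _ [s hs ->]|/(_ _)]; first exact: rank_tau.
move=> /(_ (\sum_(x <- dual_basis) tr O mu (sval x.1 x.2)))[].
by exists dual_basis => //; exact: dual_basisP.
Qed.

Lemma HS_rank_nonneg : hG_ge0 mu (HS_rank O mu P) /\
  (HS_rank O mu P = 0 <-> forall p : P, p = 0).
Proof.
have ide u : e (e u) = e u by rewrite /e fqK.
have m0 : haar_multiple mu 0 = 0 by apply/funext => A; rewrite /haar_multiple rmorph0 mul0r.
rewrite HS_rankE; split.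
  have := tau_ge0 uG hmu ee ide; rewrite le_eqVlt => /orP[/eqP <-|t0].
    by right.
  by left; exists (tau O e).
split=> [h p|P0].
  have t0 : tau O e = 0.
    (* Evaluation at [O], of measure 1, recovers the scalar from the set function. *)
    have := congr1 (fun m : set G -> R => m O) h.
    rewrite /haar_multiple (_ : fine (mu O) = 1) ?mulr1; last by case: hmu => _ ->.
    by move/eqP; rewrite fmorph_eq0 => /eqP.
  have e0 := tau_eq0 uG hmu ee ide t0.
  (* This is p = f q p = f (e (q p)). *)
  by rewrite -(fqK p) -(fqK (f (q p))) -/(e (q p)) e0 (lin0 ef.1).
have e0 u : e u = 0 by rewrite /e (P0 (f u)) (lin0 eq.1).
rewrite /tau big1// => j _.
by rewrite e0 (lin0 (coord_linear _)) mulr0.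
Qed.

End Rank.

Theorem theoremA (R : realType) (G : topologicalGroupType)
    (hG : tdlc G) (uG : unimodular R G)
    (O : CO G) (mu_O : {measure set (borel G) -> \bar R})
    (hmu : normalized_haar O mu_O)
    (P : leftGModType G) (fgP : finitely_generated P) (projP : projective P) :
  hG_ge0 mu_O (HS_rank O mu_O P) /\
  (HS_rank O mu_O P = 0 <-> forall p : P, p = 0).
Proof.
have [dP lift] := projP; have [n [U [f fsurj]]] := fgP.
have idE : equivariant_linear (id : P -> P) by split.
have [q qK] := lift (pmod U) P f (mkHom idE) (@pmod_discrete G n U) dP fsurj.
apply: (@HS_rank_nonneg R G O mu_O uG hmu P dP n U (sval f) (sval q)) => //; exact: HomP.
Qed.
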